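(* Let $\mathscr{C}$ be the set of all pairs $(W,\mu)$ with $\mu\in\mathbb{R}$ and $W=W^T=\begin{bmatrix} W_1 & W_2\\ W_2^T & W_3\end{bmatrix}\in\mathbb{S}^{m+n}$, where $W_1\in\mathbb{S}^n$ is positive definite, $W_2\in\mathbb{R}^{n\times m}$ and $W_3\in\mathbb{S}^m$, such that $W\succeq 0$, $\Theta_1(W,\mu)\preceq 0$ and $\mu>0$. Then the following statements hold: (a) $\mathscr{C}$ is a convex set. (b) Any $(W,\mu)\in\mathscr{C}$ generates a stabilizing gain $K=W_2^TW_1^{-1}$ (that is, $A-B_2K$ is asymptotically stable) that guarantees $\|H(s)\|_\infty\le\gamma$ with $\gamma=1/\sqrt{\mu}>0$. (c) At optimality, $(W^*,\mu^* )=\operatorname{argmax}\{\mu:(W,\mu)\in\mathscr{C}\}$ gives the optimal solution to the optimal $\mathcal{H}_\infty$ control problem, with optimal gain $K^*={W_2^*}^{T}{W_1^*}^{-1}$ and optimal value $\|H(s)\|_\infty^*=\gamma^*=1/\sqrt{\mu^*}$.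
   Context: $\mathbb{S}^k$ denotes the real symmetric $k\times k$ matrices; $M\succeq 0$ ($M\succ 0$) means $M$ is positive semi-definite (positive definite), and $M\preceq 0$ means $-M\succeq 0$. System: $\dot x=Ax+B_2u+B_1w$, $z=Cx+Du$, $u=-Kx$, with state $x\in\mathbb{R}^n$, control input $u\in\mathbb{R}^m$, disturbance $w\in\mathbb{R}^l$, controlled output $z\in\mathbb{R}^q$, and static state-feedback gain $K\in\mathbb{R}^{m\times n}$; all matrices are real, constant and of compatible dimensions. Standing assumptions: $[A,B_2]$ is stabilizable with disturbance attenuation $\gamma$ (i.e. there is a gain $K$ for which $A-B_2K$ is asymptotically stable and $\|H(s)\|_\infty\le\gamma$, for some $\gamma>0$), $[A,C]$ is observable, $C^TD=0$, and $D^TD\succ 0$. With $A_c=A-B_2K$ and $C_c=C-DK$, the closed-loop transfer function from $w$ to $z$ is $H(s)=C_c(sI_n-A_c)^{-1}B_1$, and $\|H(s)\|_\infty=\sup_\omega\sigma_{\mathrm M}[H(j\omega)]$, where $\sigma_{\mathrm M}$ is the maximum singular value. A gain $K$ is stabilizing if $A_c$ is asymptotically stable (all eigenvalues have negative real part). The optimal $\mathcal{H}_\infty$ control problem is to find a state-feedback gain $K$ minimizing $\|H(s)\|_\infty$ subject to closed-loop stability; $\|H(s)\|_\infty^*$ denotes the optimal value. Put $p=m+n$ and $$F=\begin{bmatrix}A&-B_2\\0&0\end{bmatrix}\in\mathbb{R}^{p\times p},\quad Q=\begin{bmatrix}B_1B_1^T&0\\0&0\end{bmatrix}\in\mathbb{S}^p,\quad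 R=\begin{bmatrix}C^TC&0\\0&D^TD\end{bmatrix}\in\mathbb{S}^p.$$ Define $\Theta(W,\mu)=FW+WF^T+WRW+\mu Q$, with $\mu=1/\gamma^2$, and let $\Theta_1(W,\mu)\in\mathbb{S}^n$ be its upper-left $n\times n$ block. Explicitly, $$\Theta_1(W,\mu)=AW_1-B_2W_2^T+W_1A^T-W_2B_2^T+W_1C^TCW_1+W_2D^TDW_2^T+\mu B_1B_1^T.$$ *)

(* Defs.v *)
From mathcomp Require Import all_boot all_order all_algebra.
From mathcomp Require Import all_classical all_reals all_analysis.
From mathcomp Require Export complex.

Set Implicit Arguments.
Unset Strict Implicit.
Unset Printing Implicit Defensive.

Import Order.TTheory GRing.Theory Num.Theory.
Import numFieldNormedType.Exports.

Local Open Scope classical_set_scope.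
Local Open Scope sesquilinear_scope.
Local Open Scope complex_scope.
Local Open Scope ring_scope.

Definition psdmx (R : realType) (k : nat) (M : 'M[R]_k) : Prop :=
  M^T = M /\ forall x : 'cV[R]_k, 0 <= (x^T *m M *m x) 0 0.

Definition pdmx (R : realType) (k : nat) (M : 'M[R]_k) : Prop :=
  M^T = M /\ forall x : 'cV[R]_k, x != 0 -> 0 < (x^T *m M *m x) 0 0.

Definition mxC (R : realType) (a b : nat) (M : 'M[R]_(a, b)) : 'M[R[i]]_(a, b) :=
  map_mx (real_complex R) M.

Definition asymptotically_stable (R : realType) (n : nat) (A : 'M[R]_n) : Prop :=
  forall s : R[i], eigenvalue (mxC A) s -> complex.Re s < 0.

Definition trajectory (R : realType) (n : nat) (A : 'M[R]_n)
    (x : R -> 'cV[R]_n) : Prop :=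
  forall (t : R) (i : 'I_n),
    is_derive t (1 : R) (fun s : R => x s i 0) ((A *m x t) i 0).

(* The output on any interval [0, T] determines the initial state of the
   unforced system x' = A x, y = C x. *)
Definition observable (R : realType) (n q : nat)
    (A : 'M[R]_n) (C : 'M[R]_(q, n)) : Prop :=
  forall T : R, 0 < T -> forall x y : R -> 'cV[R]_n,
    trajectory A x -> trajectory A y ->
    (forall t : R, 0 <= t <= T -> C *m x t = C *m y t) ->
    x 0 = y 0.

(* The set of singular values is finite, and nonempty as soon as 0 < b; for
   b = 0 the supremum is 0 by convention. *)
Definition sigma_max (R : realType) (a b : nat) (M : 'M[R[i]]_(a, b)) : R :=
  sup [set s : R | 0 <= s /\ eigenvalue (M ^t* *m M) (s ^+ 2)%:C].

Definition closed_loop (R : realType) (n m : nat)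
    (A : 'M[R]_n) (B2 : 'M[R]_(n, m)) (K : 'M[R]_(m, n)) : 'M[R]_n :=
  A - B2 *m K.

Definition stabilizing (R : realType) (n m : nat)
    (A : 'M[R]_n) (B2 : 'M[R]_(n, m)) (K : 'M[R]_(m, n)) : Prop :=
  asymptotically_stable (closed_loop A B2 K).

Definition transfer (R : realType) (n m l q : nat)
    (A : 'M[R]_n) (B1 : 'M[R]_(n, l)) (B2 : 'M[R]_(n, m))
    (C : 'M[R]_(q, n)) (D : 'M[R]_(q, m)) (K : 'M[R]_(m, n))
    (s : R[i]) : 'M[R[i]]_(q, l) :=
  mxC (C - D *m K) *m invmx (s%:M - mxC (closed_loop A B2 K)) *m mxC B1.

(* Extended-real valued, so that an unbounded frequency response has norm +oo.
   Meaningful when the closed loop has no eigenvalue on the imaginary axis, in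
   particular for every stabilizing K. *)
Definition Hinf_norm (R : realType) (n m l q : nat)
    (A : 'M[R]_n) (B1 : 'M[R]_(n, l)) (B2 : 'M[R]_(n, m))
    (C : 'M[R]_(q, n)) (D : 'M[R]_(q, m)) (K : 'M[R]_(m, n)) : \bar R :=
  ereal_sup [set (sigma_max (transfer A B1 B2 C D K (0 +i* w)))%:E
            | w in [set: R]].

Definition stabilizable_with_attenuation (R : realType) (n m l q : nat)
    (A : 'M[R]_n) (B1 : 'M[R]_(n, l)) (B2 : 'M[R]_(n, m))
    (C : 'M[R]_(q, n)) (D : 'M[R]_(q, m)) (gamma : R) : Prop :=
  exists K : 'M[R]_(m, n),
    stabilizing A B2 K /\ (Hinf_norm A B1 B2 C D K <= gamma%:E)%E.

Definition Hinf_optimal_gain (R : realType) (n m l q : nat)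
    (A : 'M[R]_n) (B1 : 'M[R]_(n, l)) (B2 : 'M[R]_(n, m))
    (C : 'M[R]_(q, n)) (D : 'M[R]_(q, m)) (K : 'M[R]_(m, n)) : Prop :=
  stabilizing A B2 K /\
  forall K' : 'M[R]_(m, n), stabilizing A B2 K' ->
    (Hinf_norm A B1 B2 C D K <= Hinf_norm A B1 B2 C D K')%E.

Definition Hinf_optimal_value (R : realType) (n m l q : nat)
    (A : 'M[R]_n) (B1 : 'M[R]_(n, l)) (B2 : 'M[R]_(n, m))
    (C : 'M[R]_(q, n)) (D : 'M[R]_(q, m)) : \bar R :=
  ereal_inf [set Hinf_norm A B1 B2 C D K | K in [set K | stabilizing A B2 K]].

Definition Fmx (R : realType) (n m : nat)
    (A : 'M[R]_n) (B2 : 'M[R]_(n, m)) : 'M[R]_(n + m) :=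
  block_mx A (- B2) 0 0.

Definition Qmx (R : realType) (n m l : nat) (B1 : 'M[R]_(n, l)) :
    'M[R]_(n + m) :=
  block_mx (B1 *m B1^T) 0 0 0.

Definition Rmx (R : realType) (n m q : nat)
    (C : 'M[R]_(q, n)) (D : 'M[R]_(q, m)) : 'M[R]_(n + m) :=
  block_mx (C^T *m C) 0 0 (D^T *m D).

Definition Theta (R : realType) (n m l q : nat)
    (A : 'M[R]_n) (B1 : 'M[R]_(n, l)) (B2 : 'M[R]_(n, m))
    (C : 'M[R]_(q, n)) (D : 'M[R]_(q, m))
    (W : 'M[R]_(n + m)) (mu : R) : 'M[R]_(n + m) :=
  Fmx A B2 *m W + W *m (Fmx A B2)^T + W *m Rmx C D *m W + mu *: Qmx m B1.

Definition Theta1 (R : realType) (n m l q : nat)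
    (A : 'M[R]_n) (B1 : 'M[R]_(n, l)) (B2 : 'M[R]_(n, m))
    (C : 'M[R]_(q, n)) (D : 'M[R]_(q, m))
    (W : 'M[R]_(n + m)) (mu : R) : 'M[R]_n :=
  ulsubmx (Theta A B1 B2 C D W mu).

(* The symmetry of W is part of psdmx W. *)
Definition feasible_set (R : realType) (n m l q : nat)
    (A : 'M[R]_n) (B1 : 'M[R]_(n, l)) (B2 : 'M[R]_(n, m))
    (C : 'M[R]_(q, n)) (D : 'M[R]_(q, m)) : set ('M[R]_(n + m) * R^o) :=
  [set p | [/\ pdmx (ulsubmx p.1), psdmx p.1,
               psdmx (- Theta1 A B1 B2 C D p.1 p.2) & 0 < p.2]].

Definition gain (R : realType) (n m : nat) (W : 'M[R]_(n + m)) : 'M[R]_(m, n) :=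
  (ursubmx W)^T *m invmx (ulsubmx W).

(* Main.v *)
Require Import Defs.
From HB Require Import structures.
From mathcomp Require Import all_boot all_order all_algebra.
From mathcomp Require Import all_classical all_reals all_analysis.
From mathcomp Require Import ring lra.

(** Put [P = W1^-1], [K = W2^T W1^-1] and let [Ac], [Cc] be the closed-loop
    matrices.  Congruence by [W1] turns the inequality [Theta1 <= 0] into the
    bounded-real Riccati inequality
    [[
      P Ac + Ac^T P + Cc^T Cc + mu P B1 B1^T P <= 0,
    ]]
    because [C^T D = 0] makes [C^T C + K^T D^T D K] equal to [Cc^T Cc]
    ([Theta1_riccati]).  Conversely every [P > 0] satisfying it for some gain [K]
    comes from the feasible pair with [W1 = P^-1], [W2 = W1 K^T],
    [W3 = K W1 K^T] ([riccati_feasible]).  The theorem thus becomes three facts.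

    (a) Up to affine terms [Theta] is the map [W |-> W R W] with [R >= 0], which
    is convex for the order of symmetric matrices ([Theta1_convex]).

    (b) Evaluated on an eigenvector of [Ac] that is not strictly stable, the
    inequality forces [C v = 0] and [K v = 0], so that the mode is also an
    unobservable mode of [A] ([riccati_stable]).  Evaluated at
    [x = (jw - Ac)^-1 B1 u], it is a dissipation inequality which bounds
    [|H(jw) u|^2] by [|u|^2 / mu] ([bounded_real]).

    (c) Optimality is the strict converse of (b), [strict_bounded_real]: a
    stabilizing gain with norm less than [g] admits a solution [P > 0] of the
    Riccati inequality for [mu = g^-2].  If some gain did better than the
    maximal [mu] allows, a [g] strictly in between would yield a feasible pair
    with a larger [mu].

    The converse rests on the Kalman-Yakubovich-Popov lemma [kyp], proved by
    convex duality.  If the linear matrix inequality in [P] has no solution,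
    separation ([convex_alternative], on the compact set of positive
    semidefinite [Z] of trace one) yields such a [Z] with
    [E Z F^T + F Z E^T = 0] and [tr (M Z) >= 0], where [E = (A B)] and
    [F = (1 0)].  Writing [Z = V V^H], the first relation says that [(F + E) V]
    and [(F - E) V] have the same Gram matrix, hence differ by a unitary factor;
    diagonalizing that factor splits [Z] into rank-one pieces [v v^H] with
    [E v = jw F v] for some real [w], or [F v = 0] (the frequency at infinity)
    ([skew_relation_diag]).  On each piece the frequency-domain inequality makes
    [v^H M v] negative, a contradiction.  Finally [P > 0] because [Ac] is stable
    ([lyapunov_posdef]). *)

Set Implicit Arguments.
Unset Strict Implicit.
Unset Printing Implicit Defensive.

Import Order.TTheory GRing.Theory Num.Theory.
Import numFieldNormedType.Exports.
Local Open Scope classical_set_scope.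
Local Open Scope sesquilinear_scope.
Local Open Scope ring_scope.

(** * Factorizations of positive semidefinite Hermitian matrices *)

Section Entry.
Variable F : nzRingType.
Implicit Types X Y : 'M[F]_1.

Lemma mx11D X Y : (X + Y) 0 0 = X 0 0 + Y 0 0. Proof. by rewrite mxE. Qed.

Lemma mx11N X : (- X) 0 0 = - X 0 0. Proof. by rewrite mxE. Qed.

Lemma mx11Z k X : (k *: X) 0 0 = k * X 0 0. Proof. by rewrite mxE. Qed.

Definition mx11E := (mx11D, mx11N, mx11Z).

End Entry.

Section Adjoint.
Variable (C : numClosedFieldType).

Lemma adjmxM a b c (M : 'M[C]_(a, b)) (N : 'M[C]_(b, c)) :
  (M *m N)^t* = N^t* *m M^t*.
Proof. by rewrite trmx_mul map_mxM. Qed.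

Lemma adjmxD a b (M N : 'M[C]_(a, b)) : (M + N)^t* = M^t* + N^t*.
Proof. by rewrite linearD map_mxD. Qed.

Lemma adjmxB a b (M N : 'M[C]_(a, b)) : (M - N)^t* = M^t* - N^t*.
Proof. by rewrite linearB map_mxB. Qed.

Lemma adjmxN a b (M : 'M[C]_(a, b)) : (- M)^t* = - M^t*.
Proof. by rewrite linearN map_mxN. Qed.

Lemma adjmxZ a b (z : C) (M : 'M[C]_(a, b)) : (z *: M)^t* = z^* *: M^t*.
Proof. by rewrite linearZ map_mxZ. Qed.

Lemma adjmx0 a b : (0 : 'M[C]_(a, b))^t* = 0.
Proof. by rewrite trmx0 map_mx0. Qed.

Lemma adjmx1 a : (1%:M : 'M[C]_a)^t* = 1%:M.
Proof. by rewrite trmx1 map_mx1. Qed.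

Lemma hermformD a (x : 'cV[C]_a) (M N : 'M[C]_a) :
  (x^t* *m (M + N) *m x) 0 0 = (x^t* *m M *m x) 0 0 + (x^t* *m N *m x) 0 0.
Proof. by rewrite mulmxDr mulmxDl mx11D. Qed.

Lemma hermformZ a (x : 'cV[C]_a) (k : C) (M : 'M[C]_a) :
  (x^t* *m (k *: M) *m x) 0 0 = k * (x^t* *m M *m x) 0 0.
Proof. by rewrite -scalemxAr -scalemxAl mx11Z. Qed.

Lemma mul_adjmx_ge0 a (u : 'cV[C]_a) : 0 <= (u^t* *m u) 0 0.
Proof.
rewrite mxE; apply: sumr_ge0 => i _; rewrite !mxE mulrC; exact: mul_conjC_ge0.
Qed.

Lemma mul_adjmx_eq0 a (u : 'cV[C]_a) : ((u^t* *m u) 0 0 == 0) = (u == 0).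
Proof.
apply/idP/idP=> [|/eqP->]; last by rewrite mulmx0 mxE.
rewrite mxE psumr_eq0 => [/allP h|i _]; last first.
  by rewrite !mxE mulrC mul_conjC_ge0.
apply/eqP/colP => i; have := h i; rewrite mem_index_enum => /(_ isT).
by rewrite !mxE mulrC mul_conjC_eq0 => /eqP ->.
Qed.

Lemma mulmx_adj_eq0 a b (M : 'M[C]_(a, b)) : M *m M^t* = 0 -> M = 0.
Proof.
move=> h; apply/row_matrixP => i; rewrite row0.
suff h0 : (row i M)^t* = 0 by rewrite -[LHS]trmxCK h0 adjmx0.
apply/eqP; rewrite -mul_adjmx_eq0 trmxCK.
suff -> : row i M *m (row i M)^t* = 0 by rewrite mxE.
by rewrite tr_row map_col colE mulmxA rowE -(mulmxA _ M) h mulmx0 mul0mx.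
Qed.

(** Symmetrizing any generalized inverse [K] of [G] as [K G K^H] makes it
    Hermitian and reflexive, without diagonalizing [G]. *)
Lemma hermitian_pinv n (G : 'M[C]_n) : G^t* = G ->
  exists H : 'M[C]_n, [/\ H^t* = H, G *m H *m G = G & H *m G *m H = H].
Proof.
move=> Gadj.
have [K GKG] : exists K, G *m K *m G = G.
  by exists (pinvmx G); rewrite mulmxKpV.
pose L := K^t*.
have GLG : G *m L *m G = G.
  have /(congr1 (fun X : 'M[C]_n => X^t*)) := GKG.
  by rewrite !adjmxM !Gadj mulmxA.
exists (K *m G *m L); split.
- by rewrite /L !adjmxM trmxCK Gadj mulmxA.
- by rewrite !mulmxA GKG GLG.
- rewrite !mulmxA -(mulmxA (K *m G) L) -(mulmxA K) (mulmxA G L) GLG.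
  by rewrite -(mulmxA K) -(mulmxA K) GKG.
Qed.

Section GramDilation.
Variables (n r : nat) (M N : 'M[C]_(n, r)).
Hypothesis eqG : M *m M^t* = N *m N^t*.

(** [V = N^H (N N^H)^+ M] is a partial isometry with [N V = M].  Its complements
    [1 - V V^H] and [1 - V^H V] are projections, so that the block matrix below
    is a unitary dilation; the price is the padding of [M] and [N] by zero
    columns, which does not change their Gram matrices. *)
Lemma gram_eq_unitary : exists2 W : 'M[C]_(r + r),
  W \is unitarymx & row_mx M 0 = row_mx N 0 *m W :> 'M[C]_(n, r + r).
Proof.
have Gadj : (N *m N^t*)^t* = N *m N^t* by rewrite adjmxM trmxCK.
move: eqG Gadj; move eqN : (N *m N^t*) => G eqM Gadj.
have [H [Hadj GHG HGH]] := hermitian_pinv Gadj.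
have rangeM (L : 'M[C]_(n, r)) : L *m L^t* = G -> G *m H *m L = L.
  move=> LG; apply/eqP; rewrite -subr_eq0; apply/eqP/mulmx_adj_eq0.
  rewrite adjmxB mulmxBr mulmxBl !adjmxM Gadj Hadj.
  rewrite mulmxBl !mulmxA -![_ *m L *m L^t*]mulmxA LG GHG subrr.
  by rewrite GHG subrr subr0.
have GHM := rangeM M eqM; have GHN := rangeM N eqN.
pose V := N^t* *m H *m M.
have Vadj : V^t* = M^t* *m H *m N by rewrite !adjmxM trmxCK Hadj mulmxA.
have VVt : V *m V^t* = N^t* *m H *m N.
  rewrite Vadj /V !mulmxA -(mulmxA _ M) eqM -(mulmxA (N^t*)) -(mulmxA (N^t*)).
  by rewrite HGH.
have VtV : V^t* *m V = M^t* *m H *m M.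
  rewrite Vadj /V !mulmxA -(mulmxA _ N) eqN -(mulmxA (M^t*)) -(mulmxA (M^t*)).
  by rewrite HGH.
have VVtV : V *m V^t* *m V = V.
  rewrite VVt /V !mulmxA -(mulmxA _ N) eqN -(mulmxA (N^t*)) -(mulmxA (N^t*)).
  by rewrite HGH.
have VtVVt : V^t* *m V *m V^t* = V^t*.
  rewrite VtV Vadj !mulmxA -(mulmxA _ M) eqM -(mulmxA (M^t*)) -(mulmxA (M^t*)).
  by rewrite HGH.
have NV : N *m V = M by rewrite /V !mulmxA eqN GHM.
have NVVt : N *m (V *m V^t*) = N by rewrite VVt !mulmxA eqN GHN.
move: V {Vadj VVt VtV} VVtV VtVVt NV NVVt => V VVtV VtVVt NV NVVt.
have k1 : V *m (1%:M - V^t* *m V) = 0.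
  by rewrite mulmxBr mulmx1 mulmxA VVtV subrr.
have k2 : (1%:M - V *m V^t*) *m V = 0 by rewrite mulmxBl mul1mx VVtV subrr.
have k3 : (1%:M - V^t* *m V) *m V^t* = 0.
  by rewrite mulmxBl mul1mx VtVVt subrr.
have k4 : V^t* *m (1%:M - V *m V^t*) = 0.
  by rewrite mulmxBr mulmx1 mulmxA VtVVt subrr.
exists (block_mx V (1%:M - V *m V^t*) (1%:M - V^t* *m V) (- V^t*)).
  apply/unitarymxP; rewrite tr_block_mx map_block_mx mulmx_block.
  have -> : (- V^t*)^t* = - V by rewrite adjmxN trmxCK.
  rewrite !adjmxB !adjmx1 !adjmxM trmxCK scalar_mx_block.
  congr block_mx.
  - by rewrite [X in _ + X]mulmxBr mulmx1 mulmxA k2 mul0mx subr0 addrC subrK.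
  - by rewrite mulmxN k1 k2 subrr.
  - by rewrite mulNmx k3 k4 subrr.
  - rewrite mulNmx mulmxN opprK mulmxBr mulmx1 mulmxA k3 mul0mx subr0.
    by rewrite subrK.
rewrite mul_row_block !mul0mx !addr0 mulmxBr mulmx1.
by rewrite NV NVVt subrr.
Qed.

End GramDilation.

(** The hypothesis is the difference of the Gram matrices of [(F + E) V] and
    [(F - E) V].  The two matrices therefore differ by a unitary factor, and the
    columns of [U] come from an orthonormal eigenbasis of that factor. *)
Lemma skew_relation_diag n N r (E F : 'M[C]_(n, N)) (V : 'M[C]_(N, r)) :
  E *m (V *m V^t*) *m F^t* + F *m (V *m V^t*) *m E^t* = 0 ->
  exists (U : 'M[C]_(N, r + r)) (d : 'rV[C]_(r + r)),
    [/\ U *m U^t* = V *m V^t*, forall k, d 0 k * (d 0 k)^* = 1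
      & forall k, (F + E) *m col k U = d 0 k *: ((F - E) *m col k U)].
Proof.
move=> h.
have eqG : ((F + E) *m V) *m ((F + E) *m V)^t* = ((F - E) *m V) *m ((F - E) *m V)^t*.
  apply/eqP; rewrite -subr_eq0; apply/eqP.
  rewrite !adjmxM adjmxD adjmxB -!mulmxA !(mulmxA V).
  move: h; rewrite -!mulmxA; move: (V *m V^t*) => Z h.
  rewrite !(mulmxDl, mulmxDr, mulmxN, mulNmx) opprK.
  move/eqP: h; rewrite addr_eq0 => /eqP ->.
  by rewrite opprK !addrA addrK subrK subrr.
have [W Wu eqW] := gram_eq_unitary eqG.
have WW : W *m W^t* = 1%:M by apply/unitarymxP.
have Wn : W \is normalmx by apply/normalmxP; rewrite WW (mulmx1C WW).
have := orthomx_spectralP Wn; set Q := spectralmx W; set d := spectral_diag W.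
have Qu : Q \is unitarymx by exact: spectral_unitarymx.
rewrite invmx_unitary // => Wdec.
have QQ : Q *m Q^t* = 1%:M by apply/unitarymxP.
have QQ' : Q^t* *m Q = 1%:M by apply: mulmx1C.
pose U := row_mx V 0 *m Q^t*.
exists U, d; split.
- rewrite /U adjmxM trmxCK mulmxA -(mulmxA _ (Q^t*)) QQ' mulmx1.
  by rewrite tr_row_mx map_col_mx mul_row_col mul0mx addr0.
- move=> k; have : diag_mx d *m (diag_mx d)^t* = 1%:M.
    have -> : diag_mx d = Q *m W *m Q^t*.
      by rewrite Wdec !mulmxA QQ mul1mx -mulmxA QQ mulmx1.
    rewrite !adjmxM trmxCK !mulmxA -(mulmxA _ (Q^t*)) QQ' mulmx1.
    by rewrite -(mulmxA _ W) WW mulmx1 QQ.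
  rewrite tr_diag_mx map_diag_mx mulmx_diag => /matrixP/(_ k k).
  by rewrite !mxE eqxx !mulr1n.
- have : (F + E) *m U = (F - E) *m U *m diag_mx d.
    rewrite /U !mulmxA !mul_mx_row !mulmx0 eqW Wdec !mulmxA -!mulmxA QQ.
    by rewrite mulmx1.
  move=> eqU k; rewrite !colE !(mulmxA _ U) eqU -!colE mul_mx_diag.
  by apply/colP => i; rewrite !mxE mulrC.
Qed.

Lemma psd_spectral N (Z : 'M[C]_N) : Z^t* = Z ->
  (forall x : 'cV[C]_N, 0 <= (x^t* *m Z *m x) 0 0) ->
  exists (Q : 'M[C]_N) (d : 'rV[C]_N),
    [/\ Q *m Q^t* = 1%:M, forall k, 0 <= d 0 k & Z = Q^t* *m diag_mx d *m Q].
Proof.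
move=> Zh Zp.
have Zn : Z \is normalmx by apply/normalmxP; rewrite Zh.
have := orthomx_spectralP Zn; set Q := spectralmx Z; set d := spectral_diag Z.
have Qu : Q \is unitarymx by exact: spectral_unitarymx.
rewrite invmx_unitary // => Zdec.
have QQ : Q *m Q^t* = 1%:M by apply/unitarymxP.
exists Q, d; split=> // k.
have := Zp (Q^t* *m delta_mx k 0).
rewrite adjmxM trmxCK Zdec -!mulmxA !(mulmxA Q) QQ !mul1mx.
rewrite mul_diag_mx mxE (bigD1 k) //= big1 ?addr0 => [|j jk].
  by rewrite !mxE !eqxx conjC1 mul1r mulr1.
by rewrite !mxE (negPf jk) conjC0 mul0r.
Qed.

Lemma psd_gram N (Z : 'M[C]_N) : Z^t* = Z ->
  (forall x : 'cV[C]_N, 0 <= (x^t* *m Z *m x) 0 0) ->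
  exists V : 'M[C]_N, Z = V *m V^t*.
Proof.
move=> Zh /(psd_spectral Zh)[Q [d [_ d0 ->]]].
exists (Q^t* *m diag_mx (\row_k sqrtC (d 0 k))).
rewrite adjmxM trmxCK -!mulmxA; congr (_ *m _).
rewrite mulmxA; congr (_ *m _).
rewrite tr_diag_mx map_diag_mx mulmx_diag; congr diag_mx.
apply/rowP => k.
have sr : (sqrtC (d 0 k))^* = sqrtC (d 0 k).
  by rewrite conj_Creal ?ger0_real ?sqrtC_ge0.
by rewrite !mxE /= sr -expr2 sqrtCK.
Qed.

End Adjoint.

(** * The Lyapunov inequality *)

Lemma unitmx_ker0 (F : fieldType) n (A : 'M[F]_n) :
  (forall u : 'rV_n, u *m A = 0 -> u = 0) -> A \in unitmx.
Proof.
move=> A0; rewrite -row_free_unit -kermx_eq0; apply/negPn/negP => /rowV0Pn.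
by case=> u /sub_kermxP/A0 -> /eqP.
Qed.

Section Lyapunov.
Variable (C : numClosedFieldType).

(** Induction on the flag of invariant subspaces of [T].  [P] is positive on the
    invariant hyperplane by induction.  The [P]-orthogonal complement of that
    hyperplane is spanned by a vector [v], and [T v] differs from [a v] by an
    element of the hyperplane; hence the Lyapunov form at [v] is
    [(a + a^conj) (v^H P v)], which forces [v^H P v > 0]. *)
Lemma lyapunov_trig n (T P : 'M[C]_n) :
  is_trig_mx T -> (forall i, T i i + (T i i)^* < 0) -> P^t* = P ->
  (forall x : 'cV_n, x != 0 ->
     (x^t* *m (T^t* *m P + P *m T) *m x) 0 0 < 0) ->
  forall x : 'cV_n, x != 0 -> 0 < (x^t* *m P *m x) 0 0.
Proof.
elim: n T P => [|n IH] T P Ttrig Tdiag Padj L x x0.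
  by rewrite (flatmx0 x) eqxx in x0.
move: T P Ttrig Tdiag Padj L x x0; rewrite -[n.+1]/(1 + n)%N => T P.
rewrite -(submxK T) -(submxK P).
move: (ulsubmx T) (ursubmx T) (dlsubmx T) (drsubmx T) => a b c T'.
move: (ulsubmx P) (ursubmx P) (dlsubmx P) (drsubmx P) => pi p' p P'.
rewrite is_trig_block_mx // => /and3P[/eqP -> _ T'trig] Tdiag.
rewrite tr_block_mx map_block_mx => /eq_block_mx[piadj p'adj padj P'adj] L.
have T'diag i : T' i i + (T' i i)^* < 0.
  by have := Tdiag (rshift 1 i); rewrite block_mxEdr.
have a0 : a 0 0 + (a 0 0)^* < 0.
  by have := Tdiag (lshift n 0); rewrite block_mxEul.
have {}IH : forall x : 'cV_n, x != 0 -> 0 < (x^t* *m P' *m x) 0 0.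
  apply: (IH T') => // x x0.
  have := L (col_mx 0 x); rewrite col_mx_eq0 eqxx /= => /(_ x0).
  rewrite tr_block_mx map_block_mx !mulmx_block add_block_mx.
  rewrite tr_col_mx map_row_mx -mulmxA mul_block_col mul_row_col.
  by rewrite !adjmx0 !mul0mx !mulmx0 !add0r -mulmxA.
have P'unit : P' \in unitmx.
  apply: unitmx_ker0 => u uP; apply/eqP/negPn/negP => u0.
  have /IH : u^t* != 0 by apply: contra u0 => /eqP h; rewrite -(trmxCK u) h adjmx0.
  by rewrite trmxCK uP mul0mx mxE ltxx.
pose w : 'cV_n := - (invmx P' *m p).
have Pw : P' *m w = - p by rewrite mulmxN mulKVmx.
have w'P : w^t* *m P' = - p'.
  by rewrite -[w^t* *m _]trmxCK adjmxM P'adj trmxCK Pw adjmxN p'adj.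
move: w Pw w'P => w Pw w'P.
(* [v] is [P]-orthogonal to the invariant hyperplane, and [s = v^H P v] is the
   Schur complement of [P']. *)
pose v : 'cV_(1 + n) := col_mx 1%:M w.
pose s := pi + p' *m w.
have Pv : block_mx pi p' p P' *m v = col_mx s 0.
  by rewrite mul_block_col !mulmx1 Pw subrr.
have vP : v^t* *m block_mx pi p' p P' = row_mx (s^t* ) 0.
  rewrite -[v^t* *m _]trmxCK adjmxM trmxCK tr_block_mx map_block_mx.
  by rewrite piadj p'adj padj P'adj Pv tr_col_mx map_row_mx adjmx0.
have sadj : s^t* = s.
  rewrite /s adjmxD adjmxM piadj padj; congr (_ + _).
  rewrite -[p' in RHS]opprK -w'P mulNmx -mulmxA Pw.
  by rewrite mulmxN opprK.
move: s Pv vP sadj => s Pv vP sadj.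
have s0 : 0 < s 0 0.
  have := L v; rewrite /v col_mx_eq0 oner_eq0 => /(_ isT).
  rewrite -/v mulmxDr mulmxDl -!mulmxA Pv.
  have Tv : block_mx a 0 c T' *m v = col_mx a (c + T' *m w).
    by rewrite mul_block_col !mulmx1 mul0mx addr0.
  rewrite Tv mulmxA -adjmxM Tv !mulmxA vP tr_col_mx map_row_mx.
  rewrite !mul_row_col mulmx0 mul0mx !addr0 sadj.
  have -> : (a^t* *m s + s *m a) 0 0 = (a 0 0 + (a 0 0)^*) * s 0 0.
    by rewrite !mxE !big_ord1 !mxE mulrDl addrC (mulrC (a 0 0)).
  by rewrite nmulr_rlt0.
move=> x; rewrite -(vsubmxK x).
move: (usubmx x) (dsubmx x) => al y.
move=> x0; pose z := y - w *m al.
have -> : col_mx al y = v *m al + col_mx 0 z.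
  by rewrite mul_col_mx mul1mx add_col_mx addr0 addrC subrK.
have e1 : v^t* *m (block_mx pi p' p P' *m (v *m al)) = s *m al.
  rewrite (mulmxA _ v) Pv mul_col_mx mul0mx tr_col_mx map_row_mx mul_row_col.
  by rewrite adjmx1 mul1mx mulmx0 addr0.
have e2 : (col_mx 0 z)^t* *m (block_mx pi p' p P' *m (v *m al)) = 0.
  rewrite (mulmxA _ v) Pv mul_col_mx mul0mx tr_col_mx map_row_mx mul_row_col.
  by rewrite adjmx0 mul0mx mulmx0 addr0.
have e3 : v^t* *m (block_mx pi p' p P' *m col_mx 0 z) = 0.
  by rewrite mulmxA vP mul_row_col mulmx0 mul0mx addr0.
have e4 : (col_mx 0 z)^t* *m (block_mx pi p' p P' *m col_mx 0 z) =
    z^t* *m P' *m z.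
  rewrite mul_block_col !mulmx0 !add0r tr_col_mx map_row_mx mul_row_col.
  by rewrite adjmx0 mul0mx add0r mulmxA.
rewrite adjmxD adjmxM !(mulmxDl, mulmxDr) -!mulmxA e1 e2 e3 e4.
rewrite mulmx0 add0r addr0 mxE.
have -> : (al^t* *m (s *m al)) 0 0 = s 0 0 * (al 0 0 * (al 0 0)^*).
  by rewrite !mxE !big_ord1 !mxE big_ord1 mulrCA (mulrC _^*).
have [z0|/IH zP] := eqVneq z 0; last first.
  by rewrite ltr_wpDl // mulr_ge0 ?mul_conjC_ge0 // ltW.
rewrite z0 mulmx0 mxE addr0 pmulr_rgt0 // mul_conjC_gt0.
apply: contra x0 => /eqP al0.
have al0' : al = 0 by apply/matrixP => i j; rewrite !ord1 al0 mxE.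
have y0 : y = 0 by rewrite -z0 /z al0' mulmx0 subr0.
by rewrite col_mx_eq0 al0' y0 !eqxx.
Qed.

(** A Schur decomposition turns [A] into a triangular matrix whose diagonal
    consists of eigenvalues of [A]. *)
Lemma lyapunov_posdef n (A P : 'M[C]_n) :
  (forall s, eigenvalue A s -> s + s^* < 0) -> P^t* = P ->
  (forall x : 'cV_n, x != 0 ->
     (x^t* *m (A^t* *m P + P *m A) *m x) 0 0 < 0) ->
  forall x : 'cV_n, x != 0 -> 0 < (x^t* *m P *m x) 0 0.
Proof.
move=> Astab Padj L x x0.
have n0 : (0 < n)%N.
  by case: n A P x x0 {Astab Padj L} => // A P x; rewrite (flatmx0 x) eqxx.
have [Q Qu] := Schur A n0; rewrite /similar_to conjymx //.
have QQ : Q *m Q^t* = 1%:M by apply/unitarymxP.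
have QQ' : Q^t* *m Q = 1%:M by apply: mulmx1C.
move TE : (Q *m A *m Q^t*) => T Ttrig.
have Tdiag i : T i i + (T i i)^* < 0.
  apply: Astab; have : eigenvalue T (T i i).
    rewrite eigenvalue_root_char char_poly_trig // rootE horner_prod (bigD1 i) //=.
    by rewrite !hornerE subrr mul0r.
  move=> /eigenvalueP[u uT u0]; apply/eigenvalueP; exists (u *m Q).
    by rewrite scalemxAl -uT -TE -!mulmxA QQ' mulmx1.
  by apply: contra u0 => /eqP h; rewrite -(mulmx1 u) -QQ mulmxA h mul0mx.
pose P1 := Q *m P *m Q^t*.
have P1adj : P1^t* = P1 by rewrite !adjmxM trmxCK Padj mulmxA.
have xE : Q^t* *m (Q *m x) = x by rewrite mulmxA QQ' mul1mx.
have := lyapunov_trig Ttrig Tdiag P1adj _ (x := Q *m x).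
have -> : ((Q *m x)^t* *m P1 *m (Q *m x)) = x^t* *m P *m x.
  rewrite adjmxM /P1 !mulmxA -(mulmxA _ (Q^t* ) Q) QQ' mulmx1.
  by rewrite -(mulmxA _ (Q^t* ) Q) QQ' mulmx1.
apply.
- move=> y y0.
  have -> : T^t* *m P1 + P1 *m T = Q *m (A^t* *m P + P *m A) *m Q^t*.
    rewrite mulmxDr mulmxDl -TE /P1 !adjmxM trmxCK !mulmxA.
    by rewrite -!(mulmxA _ (Q^t* ) Q) QQ' !mulmx1.
  have := L (Q^t* *m y); rewrite adjmxM trmxCK !mulmxA; apply.
  by apply: contra y0 => /eqP h; rewrite -(mul1mx y) -QQ -mulmxA h mulmx0.
- by apply: contra x0 => /eqP h; rewrite -xE h mulmx0.
Qed.

End Lyapunov.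

(** * A theorem of the alternative for compact convex sets *)

Section Alternative.
Variable R : realType.

(** A linear form is a finite combination of coordinates. *)
Lemma scalar_rV_continuous d (phi0 : 'rV[R]_d -> R^o) :
  scalar phi0 -> continuous phi0.
Proof.
move=> phi_lin.
pose phiM := GRing.isLinear.Build _ _ _ _ phi0 phi_lin.
pose phi : {scalar 'rV[R]_d} := HB.pack phi0 phiM.
rewrite -[phi0]/(phi : _ -> _).
suff -> : (phi : 'rV[R]_d -> R^o) =
    \sum_(k < d) (fun v : 'rV[R]_d => v 0 k * phi (delta_mx 0 k)).
  elim/big_ind: _ => [v|f g cf cg v|k _ v].
  - exact: (@cst_continuous _ _ (0 : R^o)).
  - exact: continuousD (cf v) (cg v).
  - apply: (@continuousM R _ (fun v : 'rV[R]_d => v 0 k)).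
      exact: coord_continuous.
    exact: cst_continuous.
apply/funext => v; rewrite fct_sumE [in LHS](row_sum_delta v) linear_sum.
by apply: eq_bigr => k _; rewrite linearZ.
Qed.

(** First-order condition at the endpoint of a segment. *)
Lemma quad_slope_ge0 (k s : R) : 0 <= s ->
  (forall t, 0 < t <= 1 -> 0 <= 2 * t * k + t ^+ 2 * s) -> 0 <= k.
Proof.
move=> s0 h; rewrite leNgt; apply/negP => k0.
have sk : 0 < s - k by lra.
have t01 : 0 < - k / (s - k) <= 1.
  by rewrite divr_gt0 ?oppr_gt0 //= ler_pdivrMr // mul1r; lra.
have /andP[t0 _] := t01.
have := h _ t01; move: t0; set t := - k / (s - k) => t0 ht.
have ts : t * (s - k) = - k by rewrite /t divfK // gt_eqF.
nra.
Qed.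

(** The image of [K] under [(a, b)] misses the closed ray of the points [(t, 0)]
    with [t >= 0].  The separating functional is read off the point of [K] whose
    image is closest to the ray.  It may vanish on the first coordinate; since
    the separation is strict and [a] is bounded on [K], a small positive multiple
    of [a] can be added, which gives [0 < c] in all cases. *)
Lemma convex_alternative d e (K : set 'rV[R]_d) (a : {scalar 'rV[R]_d})
    (b : {linear 'rV[R]_d -> 'rV[R]_e}) :
  compact K ->
  (forall x y t, K x -> K y -> 0 < t <= 1 -> K (x + t *: (y - x))) ->
  (forall z, K z -> b z = 0 -> a z < 0) ->
  exists (c : R) (p : 'rV[R]_e), 0 < c /\
    forall z, K z -> c * a z + (p *m (b z)^T) 0 0 < 0.
Proof.
move=> Kc Kconv sep.
have [K0|K0] := pselect (K !=set0); last first.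
  exists 1, 0; split=> // z Kz; exfalso; apply: K0; by exists z.
pose f (z : 'rV[R]_d) : R^o := Num.min (a z) 0 ^+ 2 + \sum_i (b z 0 i) ^+ 2.
have a_cont : continuous (a : _ -> R^o).
  by apply: scalar_rV_continuous => c x y; rewrite linearP.
have b_cont i : continuous (fun z => b z 0 i : R^o).
  by apply: scalar_rV_continuous => c x y; rewrite linearP !mxE.
pose f1 (z : 'rV[R]_d) : R^o := Num.min (a z) 0 ^+ 2.
pose f2 i (z : 'rV[R]_d) : R^o := b z 0 i ^+ 2.
have f_cont : continuous f.
  have -> : f = f1 + \sum_i f2 i.
    by apply/funext => z; rewrite fctE fct_sumE.
  move=> z; apply: (@continuousD R R^o _ f1).
    apply: (@continuous_comp _ _ _ (fun z => Num.min (a z) 0 : R^o)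
      (fun x : R^o => x ^+ 2)); last exact: exprn_continuous.
    by apply: continuous_min; [exact: a_cont | exact: cst_continuous].
  elim/big_ind: _ => [|g h cg ch|k _].
  - exact: (@cst_continuous _ _ (0 : R^o)).
  - exact: (@continuousD R R^o _ g h).
  - apply: (@continuous_comp _ _ _ (fun z => b z 0 k : R^o)
      (fun x : R^o => x ^+ 2)); last exact: exprn_continuous.
    exact: b_cont.
have [z0 /set_mem Kz0 z0min] := EVT_min_rV K0 Kc (continuous_subspaceT f_cont).
have f0 : 0 < f z0.
  rewrite lt_neqAle addr_ge0 ?sqr_ge0 ?sumr_ge0 // => [|i _]; last first.
    exact: sqr_ge0.
  rewrite andbT eq_sym paddr_eq0 ?sqr_ge0 ?sumr_ge0 // => [|i _]; last first.
    exact: sqr_ge0.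
  apply/negP; rewrite sqrf_eq0 => /andP[/eqP az0].
  rewrite psumr_eq0 => [/allP bz0|i _]; last exact: sqr_ge0.
  have : a z0 < 0.
    apply: sep => //; apply/rowP => i; rewrite mxE; apply/eqP.
    by rewrite -sqrf_eq0; apply: bz0; rewrite mem_index_enum.
  by move=> h; move: (h); rewrite -(min_l (ltW h)) az0 ltxx.
pose m := Num.min (a z0) 0.
have m0 : m <= 0 by rewrite /m ge_min lexx orbT.
have ma : m <= a z0 by rewrite /m ge_min lexx.
have mm : m * a z0 = m ^+ 2 :> R by rewrite /m; case: ltP => _; rewrite expr2 ?mul0r.
pose S := \sum_i b z0 0 i ^+ 2.
have fz0 : f z0 = m ^+ 2 + S by [].
have dir z : K z -> f z0 <= m * a z + \sum_i b z0 0 i * b z 0 i.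
  move=> Kz.
  pose al := a z - a z0; pose be i := b z 0 i - b z0 0 i.
  suff : 0 <= m * al + \sum_i b z0 0 i * be i.
    have -> : \sum_i b z0 0 i * be i = \sum_i b z0 0 i * b z 0 i - S.
      by rewrite -sumrB; apply: eq_bigr => i _; rewrite /be mulrBr expr2.
    rewrite /al mulrBr mm fz0; lra.
  (* Moving from z0 towards z, compare with the fixed point (a z0 - m, 0) of the
     ray, which is the one closest to the image of z0. *)
  apply: (@quad_slope_ge0 _ (al ^+ 2 + \sum_i be i ^+ 2)).
    by rewrite addr_ge0 ?sqr_ge0 // sumr_ge0 // => i _; apply: sqr_ge0.
  move=> t t01.
  have := z0min _ (mem_set (Kconv _ _ _ Kz0 Kz t01)).
  rewrite fz0 /f.
  have -> : a (z0 + t *: (z - z0)) = a z0 + t * al.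
    by rewrite linearD linearZ linearB.
  have -> : \sum_i b (z0 + t *: (z - z0)) 0 i ^+ 2 =
      S + 2 * t * (\sum_i b z0 0 i * be i) + t ^+ 2 * \sum_i be i ^+ 2.
    rewrite !mulr_sumr -!big_split; apply: eq_bigr => i _ /=.
    by rewrite linearD linearZ linearB !mxE /be; ring.
  have : Num.min (a z0 + t * al) 0 ^+ 2 <= (m + t * al) ^+ 2.
    have [x0|x0] := ltP (a z0 + t * al) 0; last by rewrite expr0n sqr_ge0.
    nra.
  move: (\sum_i _) (\sum_i _) (_ ^+ 2) => S1 S2 y y1 y2.
  nra.
have [A1 [A10 aA]] : exists A1, 0 < A1 /\ forall z, K z -> a z <= A1.
  have [z1 _ z1max] := EVT_max_rV K0 Kc (continuous_subspaceT a_cont).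
  exists (`|a z1| + 1); split=> [|z Kz]; first by rewrite ltr_wpDl.
  by rewrite (le_trans (z1max _ (mem_set Kz))) // (le_trans (ler_norm _)) // lerDl.
have ep0 : 0 < f z0 / (2 * A1) by rewrite divr_gt0 // mulr_gt0.
exists (f z0 / (2 * A1) - m), (- b z0); split; first by lra.
move=> z Kz.
have -> : (- b z0 *m (b z)^T) 0 0 = - \sum_i b z0 0 i * b z 0 i.
  by rewrite mulNmx !mxE; congr (- _); apply: eq_bigr => i _; rewrite mxE.
have h1 := dir z Kz.
have : f z0 / (2 * A1) * a z <= f z0 / (2 * A1) * A1.
  by rewrite ler_pM2l // aA.
have -> : f z0 / (2 * A1) * A1 = f z0 / 2 by field; rewrite gt_eqF.
rewrite mulrBl; lra.
Qed.

End Alternative.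

(** * Complexification and the spectahedron *)

Local Open Scope complex_scope.
Local Open Scope ring_scope.

Section Complexification.
Variable R : realType.

Lemma mxC_adj a b (M : 'M[R]_(a, b)) : (mxC M)^t* = mxC M^T.
Proof. by apply/matrixP => i j; rewrite !mxE; exact: conjc_real. Qed.

Lemma mxCM a b c (M : 'M[R]_(a, b)) (N : 'M[R]_(b, c)) :
  mxC (M *m N) = mxC M *m mxC N.
Proof. exact: map_mxM. Qed.

Lemma mxCD a b (M N : 'M[R]_(a, b)) : mxC (M + N) = mxC M + mxC N.
Proof. exact: map_mxD. Qed.

Lemma mxCB a b (M N : 'M[R]_(a, b)) : mxC (M - N) = mxC M - mxC N.
Proof. exact: map_mxB. Qed.

Lemma mxCN a b (M : 'M[R]_(a, b)) : mxC (- M) = - mxC M.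
Proof. exact: map_mxN. Qed.

Lemma mxCZ a b (k : R) (M : 'M[R]_(a, b)) : mxC (k *: M) = k%:C *: mxC M.
Proof. exact: map_mxZ. Qed.

Lemma mxC_inj a b : injective (@mxC R a b).
Proof. exact: map_mx_inj. Qed.

Lemma mxC0 a b : mxC (0 : 'M[R]_(a, b)) = 0.
Proof. exact: map_mx0. Qed.

Lemma mxC_Re_Im a b (z : 'M[R[i]]_(a, b)) :
  z = mxC (map_mx (@complex.Re R) z) + (0 +i* 1) *: mxC (map_mx (@complex.Im R) z).
Proof.
apply/matrixP => i j; rewrite !mxE; case: (z i j) => x y /=.
by apply/eqP; rewrite eq_complex /= !(mul0r, mulr0, mul1r, subr0, addr0, add0r) !eqxx.
Qed.

(** The cross terms of the real and imaginary parts cancel by symmetry of [M]. *)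
Lemma mxC_form n (M : 'M[R]_n) (x y : 'cV[R]_n) : M^T = M ->
  let z := mxC x + (0 +i* 1) *: mxC y in
  (z^t* *m mxC M *m z) 0 0 =
    ((x^T *m M *m x) 0 0 + (y^T *m M *m y) 0 0)%:C.
Proof.
move=> Ms z; rewrite /z adjmxD adjmxZ !mxC_adj.
have -> : ((0 +i* 1 : R[i])^*)%R = - (0 +i* 1) :> R[i].
  by apply/eqP; rewrite eq_complex /= oppr0 !eqxx.
rewrite !(mulmxDl, mulmxDr) -!(scalemxAl, scalemxAr) !scalerA -!mxCM.
have -> : y^T *m M *m x = x^T *m M *m y.
  rewrite [LHS]mx11_scalar -tr_scalar_mx -mx11_scalar.
  by rewrite !trmx_mul trmxK Ms mulmxA.
have -> : - (0 +i* 1) * (0 +i* 1) = 1 :> R[i].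
  apply/eqP; rewrite eq_complex /=.
  by rewrite !(mul0r, mulr0, mulr1, subr0, addr0, add0r, opprK, oppr0) !eqxx.
by rewrite scaleNr scale1r addrA subrK !mxE rmorphD.
Qed.

Lemma mxC_psd n (M : 'M[R]_n) : psdmx M ->
  forall z : 'cV_n, 0 <= (z^t* *m mxC M *m z) 0 0.
Proof.
move=> [Ms Mp] z; rewrite [z]mxC_Re_Im mxC_form // ler0c addr_ge0 //; exact: Mp.
Qed.

Lemma mxC_pd n (M : 'M[R]_n) : pdmx M ->
  forall z : 'cV_n, z != 0 -> 0 < (z^t* *m mxC M *m z) 0 0.
Proof.
move=> [Ms Mp] z; rewrite [z]mxC_Re_Im mxC_form //.
move: (map_mx _ z) (map_mx _ z) => y x z0.
have Mp' (u : 'cV[R]_n) : 0 <= (u^T *m M *m u) 0 0.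
  have [->|/Mp/ltW//] := eqVneq u 0; by rewrite mulmx0 mxE.
have [x0|x0] := eqVneq x 0; last by rewrite ltcR ltr_wpDr // Mp.
have [y0|y0] := eqVneq y 0; last by rewrite ltcR ltr_wpDl // Mp.
by move: z0; rewrite x0 y0 !mxC0 scaler0 addr0 eqxx.
Qed.

(** Test vectors [e_i + e_j] and [e_i - e_j] bound an entry by the mean of two
    diagonal entries, themselves at most the trace. *)
Lemma psd_trace1_entry n (Z : 'M[R]_n) : psdmx Z -> \tr Z = 1 ->
  forall i j, `|Z i j| <= 1.
Proof.
move=> [Zs Zp] tr1.
have eZ i j : ((delta_mx i 0 : 'cV[R]_n)^T *m Z *m (delta_mx j 0 : 'cV_n)) 0 0
    = Z i j.
  by rewrite trmx_delta -rowE -colE !mxE.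
have d0 i : 0 <= Z i i by rewrite -eZ; apply: Zp.
have d1 i : Z i i <= 1.
  by rewrite -tr1 /mxtrace (bigD1 i) //= lerDl sumr_ge0.
move=> i j.
have sij : Z j i = Z i j by rewrite -[in RHS]Zs mxE.
have := Zp (delta_mx i 0 + delta_mx j 0).
have := Zp (delta_mx i 0 - delta_mx j 0).
rewrite !(linearD, linearN) /= !(mulmxDl, mulmxDr, mulmxN, mulNmx).
rewrite !(mx11E, eZ) sij ler_norml; move: (d1 i) (d1 j) => di dj h1 h2.
by apply/andP; split; lra.
Qed.

(** Matrices are flattened to row vectors, the setting of the Heine-Borel theorem
    and of [convex_alternative]. *)
Definition spectahedron N : set 'rV[R]_(N * N) :=
  [set v | psdmx (vec_mx v) /\ \tr (vec_mx v) = 1].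

Lemma spectahedron_compact N : compact (@spectahedron N).
Proof.
have cl (phi : 'rV[R]_(N * N) -> R^o) c : scalar phi -> closed [set v | c <= phi v].
  move=> /scalar_rV_continuous phic.
  by apply: (preimage_closed (f := phi)) (@closed_ge R c) => v _; apply: phic.
apply: (@subclosed_compact _ _
  [set v : 'rV[R]_(N * N) | forall i, v ord0 i \in `[-1, 1]]).
- have -> : @spectahedron N =
    (\bigcap_(p in [set: 'I_N * 'I_N])
       [set v : 'rV[R]_(N * N) | 0 <= vec_mx v p.1 p.2 - vec_mx v p.2 p.1])
    `&` (\bigcap_(x in [set: 'cV[R]_N]) [set v | 0 <= (x^T *m vec_mx v *m x) 0 0])
    `&` ([set v | 1 <= \tr (vec_mx v)] `&` [set v | -1 <= - \tr (vec_mx v)]).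
    apply/seteqP; split => v /=.
      move=> [[vs vp] vt]; split; last by rewrite vt !lexx.
      split=> [p _|x _]; last exact: vp.
      have := congr1 (fun X : 'M[R]_N => X p.2 p.1) vs; rewrite /= mxE => ->.
      by rewrite subrr.
    move=> [[h1 h2] [h3 h4]]; split; last by apply/eqP; rewrite eq_le h3 -lerN2 h4.
    split=> [|x]; last exact: (h2 x I).
    apply/matrixP => i j; rewrite mxE; apply/eqP; rewrite eq_le.
    by rewrite -subr_ge0 (h1 (i, j) I) -subr_ge0 (h1 (j, i) I).
  apply: closedI; first apply: closedI.
  - apply: closed_bigI => p _; apply: cl => c x y /=.
    by rewrite !linearP !mxE; ring.
  - apply: closed_bigI => p _; apply: cl => c x y /=.
    by rewrite linearP mulmxDr mulmxDl -scalemxAr -scalemxAl !mxE.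
  - by apply: closedI; apply: cl => c x y /=; rewrite !linearP // -scalerN opprD.
- apply: (@rV_compact R _ (fun=> `[-1, 1]%classic)) => _; exact: segment_compact.
- move=> v /= [vp vt] i.
  have := psd_trace1_entry vp vt; case/mxvec_indexP: i => i j /(_ i j).
  by rewrite -[v]vec_mxK mxvecE mxvecK in_itv /= -ler_norml.
Qed.

End Complexification.

(** * The Kalman-Yakubovich-Popov lemma *)

Section KYP.
Variable R : realType.

(** The inverse Cayley transform sends the unit circle, minus one point, to the
    imaginary axis. *)
Lemma cayley_imaginary (d : R[i]) : d * (d^*)%R = 1 -> d != -1 ->
  exists w : R, d - 1 = (1 + d) * (0 +i* w).
Proof.
move=> dd dN1.
have d1 : 1 + d != 0 by rewrite addrC addr_eq0.
pose z := (d - 1) / (1 + d).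
have zE : d - 1 = (1 + d) * z by rewrite mulrC divfK.
have d1' : 1 + (d^*)%R != 0 by rewrite -(conjC1 _) -rmorphD conjC_eq0.
have zJE : (d^*)%R - 1 = (1 + (d^*)%R) * (z^*)%R.
  by rewrite -(conjC1 _) -rmorphB -rmorphD -rmorphM zE.
have zJ : (z^*)%R = - z.
  apply: (mulfI d1'); apply: (mulfI d1).
  rewrite -zJE mulrN mulrN (mulrCA (1 + d)) -zE.
  move: ((d^*)%R) dd => J dJ.
  rewrite !(mulrDl, mulrDr, mulrN, mulrBr) dJ (mulrC J) dJ; ring.
exists (complex.Im z); rewrite zE; congr (_ * _).
move: zJ; case: (z) => x y /eqP; rewrite eq_complex /= => /andP[/eqP h _].
by apply/eqP; rewrite eq_complex /= eqxx andbT; apply/eqP; lra.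
Qed.

Variables (n N : nat) (M : 'M[R]_N) (E F : 'M[R]_(n, N)).
Hypothesis freq : forall v : 'cV[R[i]]_N, v != 0 ->
  (mxC F *m v = 0 \/ exists w : R, mxC E *m v = (0 +i* w) *: (mxC F *m v)) ->
  (v^t* *m mxC M *m v) 0 0 < 0.

(** The rank-one pieces of [Z] given by [skew_relation_diag] each satisfy the
    frequency condition: a multiplier [t] other than [-1] corresponds to a
    finite frequency, and [t = -1] to [F v = 0]. *)
Lemma kyp_dual (Z : 'M[R]_N) : psdmx Z -> \tr Z = 1 ->
  E *m Z *m F^T + F *m Z *m E^T = 0 -> \tr (M *m Z) < 0.
Proof.
move=> Zpsd trZ LZ.
have ZH : (mxC Z)^t* = mxC Z by rewrite mxC_adj (proj1 Zpsd).
have [V ZV] := psd_gram ZH (mxC_psd Zpsd).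
have : mxC E *m (V *m V^t*) *m (mxC F)^t* + mxC F *m (V *m V^t*) *m (mxC E)^t* = 0.
  by rewrite -ZV !mxC_adj -!mxCM -mxCD LZ mxC0.
move=> /skew_relation_diag[U [d [UU dd Ud]]].
have col_lt0 k : col k U != 0 -> ((col k U)^t* *m mxC M *m col k U) 0 0 < 0.
  move=> /freq; apply; move: (Ud k); move: (col k U) (d 0 k) (dd k) => u t tt ut.
  have {}ut : (1 + t) *: (mxC E *m u) = (t - 1) *: (mxC F *m u).
    apply/eqP; rewrite -subr_eq0 scalerDl scalerBl !scale1r opprB.
    move/eqP: ut; rewrite -subr_eq0 mulmxDl mulmxBl scalerBr opprB => /eqP <-.
    by rewrite addrACA (addrC (mxC E *m u) (mxC F *m u)).
  have [tN1|tN1] := eqVneq t (-1).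
    left; apply/eqP; move: ut; rewrite tN1 subrr scale0r => /esym/eqP.
    rewrite scaler_eq0 => /orP[|//].
    by rewrite -opprD oppr_eq0 -[_ + _]/(2%:R) pnatr_eq0.
  right; have [w tw] := cayley_imaginary tt tN1.
  exists w; move: ut; rewrite tw -scalerA => /scalerI; apply.
  by rewrite addrC addr_eq0.
have col_le0 k : ((col k U)^t* *m mxC M *m col k U) 0 0 <= 0.
  by have [->|/col_lt0/ltW//] := eqVneq (col k U) 0; rewrite mulmx0 mxE.
have [k Uk] : exists k, col k U != 0.
  apply/existsP; apply: contraT => /existsPn U0.
  have : mxC Z = 0.
    rewrite ZV -UU; suff -> : U = 0 by rewrite mul0mx.
    apply/matrixP => i j; have /negPn/eqP/colP/(_ i) := U0 j.
    by rewrite !mxE.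
  rewrite -(mxC0 R) => /mxC_inj Z0.
  by move: trZ; rewrite Z0 mxtrace0 => /esym/eqP; rewrite oner_eq0.
rewrite -ltcR.
have -> : (\tr (M *m Z))%:C = \tr (mxC M *m mxC Z).
  by rewrite -mxCM /mxC trace_map_mx.
rewrite ZV -UU mulmxA mxtrace_mulC mulmxA /mxtrace.
have e j : (U^t* *m mxC M *m U) j j = ((col j U)^t* *m mxC M *m col j U) 0 0.
  rewrite tr_col map_row -row_mul !mxE; apply: eq_bigr => i _.
  by rewrite !mxE.
rewrite (bigD1 k) //= e; apply: (le_lt_trans _ (col_lt0 k Uk)).
by rewrite gerDl sumr_le0 // => j _; rewrite e.
Qed.

(** Duality: [kyp_dual] excludes the second branch of the alternative, and the
    functional obtained, tested on the matrices [v v^T / |v|^2], is the required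
    linear matrix inequality. *)
Lemma kyp : exists P : 'M[R]_n, P^T = P /\
  forall v : 'cV[R]_N, v != 0 ->
    (v^T *m M *m v) 0 0 + 2 * ((F *m v)^T *m P *m (E *m v)) 0 0 < 0.
Proof.
pose a0 (v : 'rV[R]_(N * N)) : R := \tr (M *m vec_mx v).
pose b0 (v : 'rV[R]_(N * N)) : 'rV[R]_(n * n) :=
  mxvec (E *m vec_mx v *m F^T + F *m vec_mx v *m E^T).
have a_lin : scalar a0.
  by move=> c x y; rewrite /a0 linearP mulmxDr -scalemxAr linearP.
have b_lin : linear b0.
  move=> c x y; rewrite /b0 -linearP; congr mxvec.
  rewrite linearP !(mulmxDr, mulmxDl) -!(scalemxAr, scalemxAl) scalerDr.
  by rewrite addrACA.
pose a : {scalar 'rV[R]_(N * N)} := HB.pack a0 (GRing.isLinear.Build _ _ _ _ a0 a_lin).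
pose b : {linear 'rV[R]_(N * N) -> 'rV[R]_(n * n)} :=
  HB.pack b0 (GRing.isLinear.Build _ _ _ _ b0 b_lin).
have conv : forall x y t, @spectahedron R N x -> spectahedron y -> 0 < t <= 1 ->
    spectahedron (x + t *: (y - x)).
  move=> x y t [[xs xp] xt] [[ys yp] yt] /andP[t0 t1].
  have -> : x + t *: (y - x) = (1 - t) *: x + t *: y.
    by rewrite scalerBr scalerBl scale1r addrA addrAC.
  rewrite /spectahedron /= linearD !linearZ /=; split; last first.
    by rewrite linearD !linearZ /= xt yt !mulr1 subrK.
  split=> [|u]; first by rewrite linearD !linearZ /= xs ys.
  rewrite mulmxDr mulmxDl -!scalemxAr -!scalemxAl mxE [X in X + _]mxE [X in _ + X]mxE.
  by rewrite addr_ge0 // mulr_ge0 ?subr_ge0 // ltW.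
have sep : forall z, spectahedron z -> b z = 0 -> a z < 0.
  move=> z [zp zt] bz; apply: kyp_dual => //.
  by apply: (can_inj mxvecK); rewrite linear0.
have [c [p [c0 cp]]] := convex_alternative (@spectahedron_compact R N) conv sep.
pose P0 : 'M[R]_n := vec_mx p.
(* The two terms of [E Z F^T + F Z E^T] pair with [P0] and its transpose; dividing
   by [c] normalizes the coefficient of [M]. *)
exists ((2 * c)^-1 *: (P0 + P0^T)); split.
  by rewrite linearZ linearD /= trmxK addrC.
move=> v v0.
pose s := (v^T *m v) 0 0; pose f := F *m v; pose e := E *m v.
have s0 : 0 < s.
  rewrite /s mxE lt_neqAle; have h i : 0 <= v^T 0 i * v i 0.
    by rewrite mxE -expr2 sqr_ge0.
  rewrite sumr_ge0 // andbT eq_sym psumr_eq0 //; apply: contra v0 => /allP v0.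
  apply/eqP/colP => i; have := v0 i; rewrite mem_index_enum => /(_ isT) /=.
  by rewrite !mxE mulf_eq0 orbb => /eqP.
pose z := mxvec (s^-1 *: (v *m v^T)).
have Kz : spectahedron z.
  rewrite /spectahedron /= mxvecK; split; last first.
    rewrite linearZ /= mxtrace_mulC /mxtrace big_ord1 -/s mulVf //.
    by rewrite gt_eqF.
  split=> [|u]; first by rewrite linearZ /= trmx_mul trmxK.
  rewrite -scalemxAr -scalemxAl mxE mulr_ge0 //; first by rewrite invr_ge0 ltW.
  have -> : u^T *m (v *m v^T) *m u = (v^T *m u)^T *m (v^T *m u).
    by rewrite trmx_mul trmxK !mulmxA.
  by rewrite mxE big_ord1 mxE -expr2 sqr_ge0.
have az : a z = s^-1 * (v^T *m M *m v) 0 0.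
  rewrite -[a z]/(\tr (M *m vec_mx z)) mxvecK -scalemxAr linearZ /= mulmxA.
  by rewrite mxtrace_mulC mulmxA /mxtrace big_ord1.
have bz : b z = s^-1 *: (mxvec (e^T^T *m f^T) + mxvec (f^T^T *m e^T)).
  rewrite -[b z]/(mxvec (E *m vec_mx z *m F^T + F *m vec_mx z *m E^T)) mxvecK.
  rewrite -[in RHS]linearD -[in RHS]linearZ; congr mxvec.
  rewrite scalerDr -!(scalemxAr, scalemxAl) !trmxK /e /f.
  by rewrite !trmx_mul !mulmxA.
have pbz : (p *m (b z)^T) 0 0 = s^-1 * (f^T *m (P0 + P0^T) *m e) 0 0.
  have tr11 (X : 'M[R]_1) : X 0 0 = X^T 0 0 by rewrite mxE.
  rewrite tr11 trmx_mul trmxK bz -scalemxAl mxE -[p]vec_mxK -/P0 mulmxDl.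
  rewrite !mxvec_dotmul !trmxK mulmxDr mulmxDl; congr (_ * _).
  rewrite mxE [RHS]mxE addrC; congr (_ + _).
  by rewrite tr11 (trmx_mul (_ *m _)) (trmx_mul _ P0) trmxK mulmxA.
have := cp z Kz; rewrite az pbz.
rewrite -scalemxAr -scalemxAl [X in 2 * X]mxE.
move: (((v^T *m M) *m v) 0 0) ((f^T *m (P0 + P0^T) *m e) 0 0) => x y h.
have -> : x + 2 * ((2 * c)^-1 * y) = s / c * (c * (s^-1 * x) + s^-1 * y).
  by field; rewrite !gt_eqF.
by rewrite pmulr_rlt0 // divr_gt0.
Qed.

End KYP.

(** * Largest singular value *)

Section SigmaMax.
Variables (R : realType) (a b : nat) (M : 'M[R[i]]_(a, b)).
Local Notation sqn u := ((u^t* *m u) 0 0).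

Lemma singular_value_le (g s : R) : 0 <= g ->
  (forall u : 'cV_b, sqn (M *m u) <= (g ^+ 2)%:C * sqn u) ->
  0 <= s /\ eigenvalue (M^t* *m M) (s ^+ 2)%:C -> s <= g.
Proof.
move=> g0 Mg [s0 /eigenvalueP[v vM v0]].
have u0 : v^t* != 0 by apply: contra v0 => /eqP h; rewrite -(trmxCK v) h adjmx0.
have u1 : 0 < sqn (v^t* ) by rewrite lt_neqAle eq_sym mul_adjmx_eq0 u0 mul_adjmx_ge0.
have := Mg (v^t* ).
have -> : sqn (M *m v^t* ) = (s ^+ 2)%:C * sqn (v^t* ).
  by rewrite adjmxM trmxCK mulmxA -(mulmxA v) vM -scalemxAl mxE.
by rewrite ler_pM2r // lecR ler_pXn2r.
Qed.

Lemma sigma_max_le (g : R) : 0 <= g ->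
  (forall u : 'cV_b, sqn (M *m u) <= (g ^+ 2)%:C * sqn u) -> sigma_max M <= g.
Proof.
move=> g0 Mg; rewrite /sigma_max; set S := [set s | _].
have [S0|S0] := pselect (S !=set0); last first.
  suff -> : S = set0 by rewrite sup0.
  by rewrite -subset0 => s Ss; apply: S0; exists s.
by apply: ge_sup => // s; apply: singular_value_le.
Qed.

Lemma sigma_max_ge0 : 0 <= sigma_max M.
Proof.
rewrite /sigma_max; set S := [set s | _].
have [Ssup|/sup_out->//] := pselect (has_sup S).
have [s Ss] := Ssup.1; apply: le_trans (ub_le_sup Ssup.2 Ss).
by case: Ss.
Qed.

(** The right singular vectors form an orthonormal basis.  The supremum defining
    [sigma_max] is over a bounded set because the sum of the eigenvalues of
    [M^H M] bounds the square of the operator norm. *)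
Lemma sigma_max_bound (u : 'cV_b) :
  sqn (M *m u) <= (sigma_max M ^+ 2)%:C * sqn u.
Proof.
pose Z := M^t* *m M.
have Zh : Z^t* = Z by rewrite adjmxM trmxCK.
have Zp (x : 'cV_b) : 0 <= (x^t* *m Z *m x) 0 0.
  by rewrite /Z mulmxA -mulmxA -adjmxM mul_adjmx_ge0.
have [Q [d [QQ d0 Zdec]]] := psd_spectral Zh Zp.
have bound (c : R[i]) : (forall k, d 0 k <= c) ->
    forall u : 'cV_b, sqn (M *m u) <= c * sqn u.
  move=> dc x.
  have QQ' : Q^t* *m Q = 1%:M by apply: mulmx1C.
  have -> : sqn x = sqn (Q *m x).
    by rewrite adjmxM mulmxA -(mulmxA (x^t* )) QQ' mulmx1.
  have -> : sqn (M *m x) = ((Q *m x)^t* *m (diag_mx d *m (Q *m x))) 0 0.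
    by rewrite !adjmxM !mulmxA -(mulmxA _ _ M) -/Z Zdec !mulmxA.
  move: (Q *m x) => y; rewrite mul_diag_mx !mxE mulr_sumr ler_sum // => k _.
  rewrite !mxE mulrCA ler_wpM2r // mulrC; exact: mul_conjC_ge0.
have sv k : exists2 s : R, 0 <= s & d 0 k = (s ^+ 2)%:C.
  have := d0 k; case: (d 0 k) => x y; rewrite lecE /= => /andP[/eqP y0 x0].
  exists (Num.sqrt x); first exact: sqrtr_ge0.
  by rewrite sqr_sqrtr // y0.
have eig k : eigenvalue Z (d 0 k).
  apply/eigenvalueP; exists (row k Q).
    rewrite -row_mul Zdec !mulmxA QQ mul1mx row_mul.
    by rewrite row_diag_mx -scalemxAl -rowE.
  apply/eqP => Q0; have /matrixP/(_ k k) := QQ.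
  have -> : (Q *m Q^t*) k k = (row k Q *m Q^t*) 0 k by rewrite -row_mul [RHS]mxE.
  by rewrite Q0 mul0mx !mxE eqxx => /esym/eqP; rewrite oner_eq0.
apply: (bound) => k; have [s s0 dk] := sv k.
rewrite dk lecR ler_pXn2r ?nnegrE ?sigma_max_ge0 //.
apply: ub_le_sup; last by split=> //; rewrite -dk.
pose g := \sum_k d 0 k.
have [g1 g10 gE] : exists2 g1 : R, 0 <= g1 & g = (g1 ^+ 2)%:C.
  have : 0 <= g by apply: sumr_ge0.
  case: (g) => x y; rewrite lecE /= => /andP[/eqP y0 x0].
  exists (Num.sqrt x); first exact: sqrtr_ge0.
  by rewrite sqr_sqrtr // y0.
exists g1 => t; apply: singular_value_le => // x; rewrite -gE; apply: bound => j.
by rewrite /g (bigD1 j) //= lerDl sumr_ge0.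
Qed.

End SigmaMax.

(** * The bounded real lemma *)

Section Dissipation.
Variables (C : numClosedFieldType) (n l q : nat).
Variables (A : 'M[C]_n) (B : 'M[C]_(n, l)) (G : 'M[C]_(q, n)) (P : 'M[C]_n).
Local Notation sqn u := ((u^t* *m u) 0 0).

(** With [y = B^H P x], substituting [A x = s x - B u] leaves
    [|G x|^2 + mu |y|^2 <= y^H u + u^H y], since [s] is imaginary; the bound
    follows by completing the square [|mu y - u|^2 >= 0]. *)
Lemma dissipation_bound (mu s : C) (x : 'cV_n) (u : 'cV_l) :
  0 < mu -> P^t* = P -> s + s^* = 0 -> s *: x = A *m x + B *m u ->
  (x^t* *m (P *m A + A^t* *m P + G^t* *m G + mu *: (P *m B *m B^t* *m P)) *m x) 0 0
    <= 0 ->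
  sqn (G *m x) <= mu^-1 * sqn u.
Proof.
move=> mu0 Padj s0 sx.
have Ax : A *m x = s *: x - B *m u by rewrite sx addrK.
pose y := B^t* *m P *m x.
have yadj : y^t* = x^t* *m P *m B by rewrite !adjmxM trmxCK Padj mulmxA.
have -> : x^t* *m (P *m A + A^t* *m P + G^t* *m G + mu *: (P *m B *m B^t* *m P)) *m x
    = (G *m x)^t* *m (G *m x) + mu *: (y^t* *m y) - (y^t* *m u + u^t* *m y).
  rewrite !(mulmxDl, mulmxDr) -scalemxAr -scalemxAl yadj /y adjmxM !mulmxA.
  rewrite -(mulmxA (x^t* *m P) A x) Ax -(adjmxM A x) Ax.
  rewrite adjmxB adjmxZ adjmxM mulmxBr !mulmxBl -!(scalemxAl, scalemxAr) !mulmxA.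
  rewrite (_ : s *: _ - _ + _ = - (x^t* *m P *m B *m u + u^t* *m B^t* *m P *m x)).
    by rewrite -addrA addrC.
  by rewrite addrACA -scalerDl s0 scale0r add0r opprD.
rewrite -subr_ge0 => h.
have := mul_adjmx_ge0 (mu *: y - u).
rewrite adjmxB adjmxZ (conj_Creal (gtr0_real mu0)) mulmxBl !mulmxBr.
rewrite -!(scalemxAl, scalemxAr) scalerA.
move: h; rewrite ler_pdivlMl // !mx11E.
move: (sqn (G *m x)) (sqn y) (sqn u) ((y^t* *m u) 0 0) ((u^t* *m y) 0 0) => a b c d e.
move=> h1 h2; rewrite -subr_ge0.
have -> : c - mu * a = mu * mu * b - mu * d - (mu * e - c) +
   mu * (0 - (a + mu * b - (d + e))) by ring.
by rewrite addr_ge0 // mulr_ge0 // ltW.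
Qed.

End Dissipation.

(** [eigenvalue] asserts a row eigenvector; a square matrix and its transpose are
    singular together. *)
Lemma right_eigenvector (F : fieldType) n (A : 'M[F]_n) s :
  eigenvalue A s -> exists2 v : 'cV_n, v != 0 & A *m v = s *: v.
Proof.
move=> /eigenvalueP[u uA u0]; apply: contrapT => h.
have : (A - s%:M)^T \in unitmx.
  apply: unitmx_ker0 => v; rewrite -[v]trmxK -trmx_mul -[in RHS]trmx0.
  move=> /trmx_inj; rewrite mulmxBl mul_scalar_mx => /eqP; rewrite subr_eq0.
  move=> /eqP vA; apply: trmx_inj; rewrite trmxK trmx0.
  apply/eqP; apply: contrapT => /negP v0.
  by apply: h; exists v^T.
rewrite unitmx_tr => Au; move: u0; apply/negP/negPn/eqP.
rewrite -[u](mulmxK Au) mulmxBr uA mul_mx_scalar subrr; exact: mul0mx.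
Qed.

Section BoundedReal.
Variables (R : realType) (n l q : nat).
Implicit Types (A P : 'M[R]_n) (B : 'M[R]_(n, l)) (C : 'M[R]_(q, n)).
Local Notation sqn u := ((u^t* *m u) 0 0).

(** Its negative semidefiniteness certifies that a stable system [(A, B, C)] has
    gain at most [1 / sqrt mu], with storage function [x^T P x]. *)
Definition riccati A B C P (mu : R) : 'M[R]_n :=
  P *m A + A^T *m P + C^T *m C + mu *: (P *m B *m B^T *m P).

Lemma riccati_sym A B C P mu : P^T = P ->
  (riccati A B C P mu)^T = riccati A B C P mu.
Proof.
move=> Ps; rewrite /riccati !linearD linearZ /= !trmx_mul !trmxK Ps.
by rewrite (addrC (A^T *m P)) !mulmxA.
Qed.

Lemma imaginaryD (w : R) : (0 +i* w) + ((0 +i* w)^*)%R = 0 :> R[i].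
Proof. by apply/eqP; rewrite eq_complex /= addr0 subrr !eqxx. Qed.

Lemma stable_resolvent_unit A (w : R) : asymptotically_stable A ->
  (0 +i* w)%:M - mxC A \in unitmx.
Proof.
move=> Astab; apply: unitmx_ker0 => u /eqP.
rewrite mulmxBr mul_mx_scalar subr_eq0 => /eqP uA; apply/eqP/negPn/negP => u0.
have /Astab : eigenvalue (mxC A) (0 +i* w) by apply/eigenvalueP; exists u.
by rewrite /= ltxx.
Qed.

(** The state [x = (jw - A)^-1 B u] is such that [jw x = A x + B u], so
    [dissipation_bound] applies at [s = jw]. *)
Lemma bounded_real A B C P mu : 0 < mu -> asymptotically_stable A ->
  P^T = P -> psdmx (- riccati A B C P mu) ->
  forall (w : R) (u : 'cV[R[i]]_l),
  sqn (mxC C *m invmx ((0 +i* w)%:M - mxC A) *m mxC B *m u) <= (mu^-1)%:C * sqn u.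
Proof.
move=> mu0 Astab Ps /mxC_psd Ric w u.
have Wu := stable_resolvent_unit w Astab.
rewrite -!mulmxA; set x := invmx _ *m _.
have sx : (0 +i* w) *: x = mxC A *m x + mxC B *m u.
  apply/eqP; rewrite addrC -subr_eq; apply/eqP.
  by rewrite -mul_scalar_mx -mulmxBl mulKVmx.
have := dissipation_bound (A := mxC A) (B := mxC B) (G := mxC C) (P := mxC P)
  (mu := mu%:C) _ _ (imaginaryD w) sx.
rewrite mxC_adj Ps -fmorphV; apply=> //; first by rewrite ltcR.
have := Ric x; rewrite mxCN mulmxN mulNmx mxE oppr_ge0.
by rewrite !mxC_adj /riccati !mxCD mxCZ !mxCM.
Qed.

Lemma lyapunov_real A P : asymptotically_stable A -> P^T = P ->
  pdmx (- (P *m A + A^T *m P)) -> pdmx P.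
Proof.
move=> Astab Ps /mxC_pd L; split=> // x x0.
rewrite -ltcR.
have -> : ((x^T *m P *m x) 0 0)%:C = ((mxC x)^t* *m mxC P *m mxC x) 0 0.
  by rewrite mxC_adj -!mxCM [RHS]mxE.
apply: (@lyapunov_posdef _ _ (mxC A)).
- move=> s /Astab; case: s => a b /= a0; rewrite ltcE /= subrr eqxx /=; lra.
- by rewrite mxC_adj Ps.
- move=> z /L; rewrite mxCN mulmxN mulNmx mxE oppr_gt0 mxCD !mxCM mxC_adj.
  by rewrite addrC.
- by apply: contra x0 => /eqP; rewrite -(mxC0 R) => /mxC_inj ->.
Qed.

(** [kyp] for [E = (A B)], [F = (1 0)] and [M = diag (C^T C, - g^2)] provides
    [P]; the choice [u = g^-2 B^T P x], which maximizes the left-hand side over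
    [u], gives the Riccati inequality, and [u = 0] gives the Lyapunov inequality
    that makes [P] positive. *)
Lemma strict_bounded_real A B C (h g : R) : asymptotically_stable A ->
  0 <= h -> h < g ->
  (forall w, sigma_max (mxC C *m invmx ((0 +i* w)%:M - mxC A) *m mxC B) <= h) ->
  exists2 P, pdmx P & psdmx (- riccati A B C P (g ^- 2)).
Proof.
move=> Astab h0 hg Hh.
have g0 : 0 < g by apply: le_lt_trans hg.
pose M : 'M[R]_(n + l) := block_mx (C^T *m C) 0 0 (- (g ^+ 2)%:M).
(* At a finite frequency [v = (x, u)] with [x = (jw - A)^-1 B u], so the form is
   [|H(jw) u|^2 - g^2 |u|^2]; at infinity [x = 0] and it is [- g^2 |u|^2]. *)
have freq (v : 'cV[R[i]]_(n + l)) : v != 0 ->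
    (mxC (row_mx 1%:M 0) *m v = 0 \/ exists w : R,
      mxC (row_mx A B) *m v = (0 +i* w) *: (mxC (row_mx 1%:M 0) *m v)) ->
    (v^t* *m mxC M *m v) 0 0 < 0.
  rewrite -(vsubmxK v); move: (usubmx v) (dsubmx v) => x u.
  rewrite /mxC !map_row_mx map_block_mx -!/(mxC _) !mul_row_col.
  rewrite !mxC0 mul0mx addr0 /mxC map_mx1 mul1mx -!/(mxC _).
  have -> : (col_mx x u)^t* *m block_mx (mxC (C^T *m C)) 0 0
        (mxC (- (g ^+ 2)%:M)) *m col_mx x u =
      (mxC C *m x)^t* *m (mxC C *m x) - (g ^+ 2)%:C *: (u^t* *m u).
    rewrite -mulmxA mul_block_col !mul0mx addr0 add0r tr_col_mx map_row_mx.
    rewrite mul_row_col mxCM mxCN adjmxM mxC_adj !mulmxA; congr (_ + _).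
    by rewrite mulmxN mulNmx /mxC map_scalar_mx mul_mx_scalar -scalemxAl.
  move=> v0; rewrite !mx11E subr_lt0.
  have u_gt0 : u != 0 -> 0 < sqn u.
    by move=> u0; rewrite lt_neqAle eq_sym mul_adjmx_eq0 u0 mul_adjmx_ge0.
  case=> [x0|[w xw]].
    rewrite x0 mulmx0 mulmx0 mxE mulr_gt0 ?ltcR ?exprn_gt0 // u_gt0 //.
    by apply: contra v0; rewrite x0 col_mx_eq0 eqxx.
  have Wu := stable_resolvent_unit w Astab.
  have xE : x = invmx ((0 +i* w)%:M - mxC A) *m (mxC B *m u).
    apply: (can_inj (mulKmx Wu)); rewrite mulKVmx // mulmxBl mul_scalar_mx -xw.
    by rewrite addrC addKr.
  have u0 : u != 0.
    apply: contra v0 => /eqP u0; move: xE; rewrite u0 !mulmx0 => ->.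
    by rewrite col_mx_eq0 !eqxx.
  have -> : mxC C *m x =
      mxC C *m invmx ((0 +i* w)%:M - mxC A) *m mxC B *m u.
    by rewrite {1}xE !mulmxA.
  apply: le_lt_trans (sigma_max_bound _ u) _.
  rewrite ltr_pM2r ?u_gt0 // ltcR ltr_pXn2r ?nnegrE ?sigma_max_ge0 ?ltW //.
  exact: le_lt_trans (Hh w) hg.
have [P [Ps PL]] := kyp freq.
have key (x : 'cV[R]_n) (u : 'cV[R]_l) : col_mx x u != 0 ->
    ((C *m x)^T *m (C *m x)) 0 0 - g ^+ 2 * (u^T *m u) 0 0
    + 2 * (x^T *m P *m (A *m x + B *m u)) 0 0 < 0.
  move=> /PL; rewrite !mul_row_col mul1mx mul0mx addr0.
  have -> // : (col_mx x u)^T *m M *m col_mx x u =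
      (C *m x)^T *m (C *m x) - (g ^+ 2) *: (u^T *m u).
    rewrite -mulmxA mul_block_col !mul0mx addr0 add0r tr_col_mx.
    rewrite mul_row_col trmx_mul !mulmxA; congr (_ + _).
    by rewrite mulmxN mulNmx mul_mx_scalar -scalemxAl.
  by rewrite !mx11E.
have trP (x y : 'cV[R]_n) : (y^T *m P *m x) 0 0 = (x^T *m P *m y) 0 0.
  have -> : y^T *m P *m x = (x^T *m P *m y)^T by rewrite !trmx_mul trmxK Ps mulmxA.
  by rewrite mxE.
have PAsym (x : 'cV[R]_n) : (x^T *m (P *m A + A^T *m P) *m x) 0 0 =
    2 * (x^T *m P *m (A *m x)) 0 0.
  rewrite mulmxDr mulmxDl mx11D mulr2n mulrDl mul1r -[X in _ = _ + X]trP.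
  by rewrite trmx_mul !mulmxA.
exists P.
  apply: (lyapunov_real Astab) => //; split.
    by rewrite linearN linearD /= !trmx_mul trmxK Ps addrC.
  move=> x x0; rewrite mulmxN mulNmx mx11N oppr_gt0 PAsym.
  have := key x 0; rewrite col_mx_eq0 (negPf x0) => /(_ isT).
  rewrite !mulmx0 [(0 : 'M[R]_1) 0 0]mxE mulr0 subr0 addr0; apply: le_lt_trans.
  rewrite lerDr mxE sumr_ge0 // => i _; rewrite mxE -expr2; exact: sqr_ge0.
split; first by rewrite linearN /= riccati_sym.
move=> x; have [->|x0] := eqVneq x 0; first by rewrite mulmx0 mxE.
pose y := B^T *m P *m x.
have := key x (g ^- 2 *: y); rewrite col_mx_eq0 (negPf x0) => /(_ isT) k.
rewrite mulmxN mulNmx mx11N oppr_ge0 ltW //; move: k.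
rewrite -scalemxAr mulmxDr -scalemxAr [(_ *: y)^T]linearZ /= -!(scalemxAl, scalemxAr).
rewrite !mx11E /riccati mulmxDr mulmxDl mulmxDr mulmxDl !mx11D PAsym.
rewrite -!(scalemxAr, scalemxAl) mx11Z.
have -> : x^T *m P *m (B *m y) = y^T *m y.
  by rewrite /y !trmx_mul trmxK Ps !mulmxA.
have -> : x^T *m (P *m B *m B^T *m P) *m x = y^T *m y.
  by rewrite /y !trmx_mul trmxK Ps !mulmxA.
have -> : x^T *m (C^T *m C) *m x = (C *m x)^T *m (C *m x).
  by rewrite trmx_mul !mulmxA.
have g2 : g ^+ 2 * g ^- 2 = 1 by rewrite divff ?expf_neq0 ?gt_eqF.
rewrite (mulrA (g ^+ 2)) g2 mul1r; lra.
Qed.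

End BoundedReal.

(** * Observability in terms of eigenvectors *)

Section Observability.
Variables (R : realType) (n q : nat) (A : 'M[R]_n) (C : 'M[R]_(q, n)).

(** The real part of [exp ((a + ib) t) (x + iy)]. *)
Definition mode (a b : R) (x y : 'cV[R]_n) (t : R) : 'cV[R]_n :=
  expR (a * t) *: (cos (b * t) *: x - sin (b * t) *: y).

Lemma is_derive_mulr (k t : R) : is_derive t (1 : R) ( *%R k) k.
Proof.
have h : is_derive t (1 : R) (k \*: @idfun R) (k *: (1 : R)) by exact: is_deriveZ.
by rewrite /GRing.scale /= mulr1 in h.
Qed.

Lemma is_derive_damped_wave (a b t x y : R) :
  is_derive t (1 : R)
    ((expR \o *%R a) * (x \*: (cos \o *%R b) - y \*: (sin \o *%R b)))
    (expR (a * t) * (cos (b * t) * (a * x - b * y) - sin (b * t) * (b * x + a * y))).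
Proof.
have de : is_derive t (1 : R) (@expR R \o *%R a) (expR (a * t) * a).
  by apply: is_derive1_comp; exact: is_derive_mulr.
have dc : is_derive t (1 : R) (@cos R \o *%R b) (- sin (b * t) * b).
  by apply: is_derive1_comp; exact: is_derive_mulr.
have ds : is_derive t (1 : R) (@sin R \o *%R b) (cos (b * t) * b).
  by apply: is_derive1_comp; exact: is_derive_mulr.
apply: is_derive_eq; rewrite !fctE /= /GRing.scale /=.
move: (expR _) (cos _) (sin _) => u v w; ring.
Qed.

Lemma mode_trajectory a b (x y : 'cV[R]_n) :
  A *m x = a *: x - b *: y -> A *m y = b *: x + a *: y ->
  trajectory A (mode a b x y).
Proof.
move=> Ax Ay t i.
have -> : (A *m mode a b x y t) i 0 = expR (a * t) *
    (cos (b * t) * (a * x i 0 - b * y i 0) - sin (b * t) * (b * x i 0 + a * y i 0)).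
  by rewrite /mode -scalemxAr mulmxBr -!scalemxAr Ax Ay !mxE.
have -> : (fun s => mode a b x y s i 0) =
    (expR \o *%R a) * (x i 0 \*: (cos \o *%R b) - y i 0 \*: (sin \o *%R b)).
  apply/funext => s; rewrite /mode !mxE !fctE /= /GRing.scale /=.
  by rewrite (mulrC (x i 0)) (mulrC (y i 0)).
exact: is_derive_damped_wave.
Qed.

Lemma mode0 a b (x y : 'cV[R]_n) : mode a b x y 0 = x.
Proof. by rewrite /mode !mulr0 expR0 cos0 sin0 !scale1r scale0r subr0. Qed.

(** If [v] is an unobservable eigenvector, the real part of [exp (s t) v] is a
    trajectory with zero output, as is the zero trajectory, so its initial value
    [Re v] vanishes.  The same applies to [- i v], whose real part is [Im v]. *)
Lemma observable_eigenvector (s : R[i]) (v : 'cV[R[i]]_n) :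
  observable A C -> mxC A *m v = s *: v -> mxC C *m v = 0 -> v = 0.
Proof.
move=> obs.
have ent k (X Y : 'cV[R]_k) i :
    (mxC X + (0 +i* 1) *: mxC Y) i 0 = X i 0 +i* Y i 0.
  rewrite !mxE; apply/eqP.
  by rewrite eq_complex /= !(mul0r, mulr0, mul1r, subr0, addr0, add0r) !eqxx.
have re0 (u : 'cV[R[i]]_n) : mxC A *m u = s *: u -> mxC C *m u = 0 ->
    map_mx (@complex.Re R) u = 0.
  rewrite {1 2 3}[u]mxC_Re_Im; move: (map_mx _ u) (map_mx _ u) => y x.
  rewrite !mulmxDr -!scalemxAr -!mxCM; case: s => a b eA eC.
  have eAi i : ((A *m x) i 0 = a * x i 0 - b * y i 0) /\
               ((A *m y) i 0 = b * x i 0 + a * y i 0).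
    move: eA => /colP/(_ i); rewrite [RHS]mxE !ent => /eqP.
    rewrite eq_complex /= => /andP[/eqP -> /eqP ->].
    by split=> //; rewrite addrC.
  have Ax : A *m x = a *: x - b *: y.
    by apply/colP => i; rewrite (eAi i).1 !mxE.
  have Ay : A *m y = b *: x + a *: y.
    by apply/colP => i; rewrite (eAi i).2 !mxE.
  have eCi i : ((C *m x) i 0 = 0) /\ ((C *m y) i 0 = 0).
    move: eC => /colP/(_ i); rewrite [RHS]mxE !ent => /eqP.
    by rewrite eq_complex /= => /andP[/eqP -> /eqP ->].
  have Cx : C *m x = 0 by apply/colP => i; rewrite (eCi i).1 mxE.
  have Cy : C *m y = 0 by apply/colP => i; rewrite (eCi i).2 mxE.
  have A0 c d : A *m 0 = c *: 0 + d *: 0 :> 'cV[R]_n.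
    by rewrite mulmx0 !scaler0 addr0.
  rewrite -[LHS](mode0 a b x y) -[RHS](mode0 a b 0 0).
  apply: (obs 1 ltr01); [exact: mode_trajectory | apply: mode_trajectory => // | ].
    by rewrite -scaleNr.
  move=> t _; rewrite /mode -!scalemxAr !mulmxBr -!scalemxAr Cx Cy.
  by rewrite !mulmx0.
move=> Av Cv.
have := re0 v Av Cv.
have := re0 ((0 -i* 1) *: v).
rewrite -!scalemxAr Av Cv scaler0 !scalerA mulrC => /(_ erefl erefl).
move=> im rl; rewrite [v]mxC_Re_Im rl mxC0 add0r.
have -> : map_mx (@complex.Im R) v = 0.
  rewrite -im; apply/matrixP => i j; rewrite !mxE.
  by case: (v i j) => c d /=; rewrite mul0r sub0r mulN1r opprK.
by rewrite mxC0 scaler0.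
Qed.

End Observability.

(** * The blocks of Theta and the Riccati inequality *)

Section Definite.
Variable R : realType.

Lemma psdmx_congr a b (M : 'M[R]_a) (S : 'M[R]_(a, b)) :
  psdmx M -> psdmx (S^T *m M *m S).
Proof.
move=> [Ms Mp]; split; first by rewrite !trmx_mul trmxK Ms mulmxA.
by move=> x; have := Mp (S *m x); rewrite trmx_mul !mulmxA.
Qed.

Lemma psdmx_gram a b (S : 'M[R]_(a, b)) : psdmx (S^T *m S).
Proof.
suff I : psdmx (1%:M : 'M[R]_a) by have := psdmx_congr S I; rewrite mulmx1.
split=> [|x]; first by rewrite trmx1.
rewrite mulmx1 mxE sumr_ge0 // => i _; rewrite mxE -expr2; exact: sqr_ge0.
Qed.

Lemma psdmxD a (M N : 'M[R]_a) : psdmx M -> psdmx N -> psdmx (M + N).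
Proof.
move=> [Ms Mp] [Ns Np]; split; first by rewrite linearD /= Ms Ns.
by move=> x; rewrite mulmxDr mulmxDl mx11D addr_ge0.
Qed.

Lemma psdmxZ a (k : R) (M : 'M[R]_a) : 0 <= k -> psdmx M -> psdmx (k *: M).
Proof.
move=> k0 [Ms Mp]; split; first by rewrite linearZ /= Ms.
by move=> x; rewrite -scalemxAr -scalemxAl mx11Z mulr_ge0.
Qed.

Lemma pdmx_psd a (M : 'M[R]_a) : pdmx M -> psdmx M.
Proof.
move=> [Ms Mp]; split=> // x; have [->|/Mp/ltW//] := eqVneq x 0.
by rewrite mulmx0 mxE.
Qed.

Lemma pdmx_unit a (M : 'M[R]_a) : pdmx M -> M \in unitmx.
Proof.
move=> [Ms Mp]; apply: unitmx_ker0 => u uM; apply/eqP/negPn/negP => u0.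
have /Mp : u^T != 0 by apply: contra u0; rewrite trmx_eq0.
by rewrite trmxK uM mul0mx mxE ltxx.
Qed.

Lemma pdmx_inv a (M : 'M[R]_a) : pdmx M -> pdmx (invmx M).
Proof.
move=> Mpd; have Mu := pdmx_unit Mpd; case: (Mpd) => Ms Mp.
split; first by rewrite trmx_inv Ms.
move=> x x0; have := Mp (invmx M *m x).
rewrite trmx_mul trmx_inv Ms mulmxKV // mulmxA; apply.
by apply: contra x0 => /eqP h; rewrite -(mulKVmx Mu x) h mulmx0.
Qed.

Lemma ulsubmx_psd a b (M : 'M[R]_(a + b)) : psdmx M -> psdmx (ulsubmx M).
Proof.
move=> Mp; have := psdmx_congr (col_mx 1%:M 0 : 'M[R]_(a + b, a)) Mp.
rewrite -{1}[M]submxK tr_col_mx mul_row_block trmx1 trmx0 !mul1mx !mul0mx !addr0.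
by rewrite mul_row_col mulmx1 mulmx0 addr0.
Qed.

End Definite.

Section ThetaRiccati.
Variables (R : realType) (n m l q : nat).
Variables (A : 'M[R]_n) (B1 : 'M[R]_(n, l)) (B2 : 'M[R]_(n, m)).
Variables (C : 'M[R]_(q, n)) (D : 'M[R]_(q, m)).
Hypothesis hCD : C^T *m D = 0.

Lemma cost_split (K : 'M[R]_(m, n)) :
  (C - D *m K)^T *m (C - D *m K) = C^T *m C + K^T *m (D^T *m D) *m K.
Proof.
have hDC : D^T *m C = 0 by rewrite -[C]trmxK -trmx_mul hCD trmx0.
rewrite [_^T]linearB /= trmx_mul !(mulmxBl, mulmxBr) !mulmxA hCD -(mulmxA _ _ C) hDC.
by rewrite mul0mx mulmx0 subr0 sub0r opprK.
Qed.

(** [W1] times the Riccati expression times [W1] replaces each [P = W1^-1] by the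
    identity; the terms quadratic in [W1] and [W1 K^T] combine by [cost_split]. *)
Lemma Theta1_riccati (W1 : 'M[R]_n) (W3 : 'M[R]_m) (K : 'M[R]_(m, n)) mu :
  W1 \in unitmx ->
  Theta1 A B1 B2 C D (block_mx W1 (W1 *m K^T) (K *m W1) W3) mu =
  W1 *m riccati (closed_loop A B2 K) B1 (C - D *m K) (invmx W1) mu *m W1.
Proof.
move=> W1u; rewrite /Theta1 /Theta /Fmx /Rmx /Qmx.
rewrite tr_block_mx !mulmx_block scale_block_mx !add_block_mx block_mxKul.
rewrite !(mul0mx, mulmx0, addr0, add0r) [(- B2)^T]linearN /=.
rewrite /riccati cost_split /closed_loop.
have expand (Ac : 'M[R]_n) : W1 *m (invmx W1 *m Ac + Ac^T *m invmx W1 +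
      (C^T *m C + K^T *m (D^T *m D) *m K) +
      mu *: (invmx W1 *m B1 *m B1^T *m invmx W1)) *m W1 =
    Ac *m W1 + W1 *m Ac^T +
      (W1 *m (C^T *m C) *m W1 + W1 *m (K^T *m (D^T *m D) *m K) *m W1) +
      mu *: (B1 *m B1^T).
  rewrite !mulmxDr !mulmxDl; congr (_ + _ + _ + _).
  - by rewrite mulKVmx.
  - by rewrite mulmxA mulmxKV.
  - by rewrite -scalemxAr -scalemxAl !mulmxA mulmxV // mul1mx mulmxKV.
rewrite expand [(A - _)^T]linearB /= trmx_mul mulmxBl mulmxBr !mulNmx !mulmxN.
by rewrite !mulmxA.
Qed.

(** On a right eigenvector [v] of the closed loop with [Re s >= 0], the Riccati
    form is a nonpositive sum of nonnegative terms, which therefore all vanish;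
    [C v = 0] and [K v = 0] make [v] an unobservable eigenvector of [A]. *)
Lemma riccati_stable (K : 'M[R]_(m, n)) (P : 'M[R]_n) mu :
  observable A C -> pdmx (D^T *m D) -> 0 < mu -> pdmx P ->
  psdmx (- riccati (closed_loop A B2 K) B1 (C - D *m K) P mu) ->
  stabilizing A B2 K.
Proof.
move=> obs DD mu0 Ppd Ric s /right_eigenvector[v v0 Av].
rewrite ltNge; apply/negP => s0.
move: Av Ric; move AcE : (closed_loop A B2 K) => Ac Av Ric.
have Pv := mxC_pd Ppd v0.
have := mxC_psd Ric v.
rewrite mxCN mulmxN mulNmx mx11N oppr_ge0.
have -> : riccati Ac B1 (C - D *m K) P mu =
   (P *m Ac + Ac^T *m P) + C^T *m C + K^T *m (D^T *m D) *m K +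
   mu *: ((B1^T *m P)^T *m (B1^T *m P)).
  by rewrite /riccati cost_split trmx_mul trmxK (proj1 Ppd) !mulmxA !addrA.
set p := (v^t* *m mxC P *m v) 0 0 in Pv.
have PA : (v^t* *m mxC (P *m Ac) *m v) 0 0 = s * p.
  by rewrite mxCM mulmxA -(mulmxA _ _ v) Av -scalemxAr mx11Z.
have AP : (v^t* *m mxC (Ac^T *m P) *m v) 0 0 = (s^*)%R * p.
  by rewrite mxCM -mxC_adj mulmxA -adjmxM Av adjmxZ -!scalemxAl mx11Z.
have gram k (G : 'M[R]_(k, n)) :
    (v^t* *m mxC (G^T *m G) *m v) 0 0 = ((mxC G *m v)^t* *m (mxC G *m v)) 0 0.
  by rewrite mxCM adjmxM mxC_adj !mulmxA.
have KDK : (v^t* *m mxC (K^T *m (D^T *m D) *m K) *m v) 0 0 =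
    ((mxC K *m v)^t* *m mxC (D^T *m D) *m (mxC K *m v)) 0 0.
  by rewrite !mxCM adjmxM mxC_adj !mulmxA.
have formE X Y Z W T x y z u t :
    (v^t* *m mxC X *m v) 0 0 = x -> (v^t* *m mxC Y *m v) 0 0 = y ->
    (v^t* *m mxC Z *m v) 0 0 = z -> (v^t* *m mxC W *m v) 0 0 = u ->
    (v^t* *m mxC T *m v) 0 0 = t ->
    (v^t* *m mxC (X + Y + Z + W + mu *: T) *m v) 0 0 =
      x + y + z + u + mu%:C * t.
  move=> <- <- <- <- <-; rewrite !mxCD mxCZ.
  apply: etrans (hermformD _ _ _) _; congr (_ + _); last exact: hermformZ.
  by do 3![apply: etrans (hermformD _ _ _) _; congr (_ + _)].
rewrite (formE _ _ _ _ _ _ _ _ _ _ PA AP (gram _ C) KDK (gram _ (B1^T *m P))).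
rewrite -mulrDl => le0.
have sp : 0 <= (s + (s^*)%R) * p.
  apply: mulr_ge0; last exact: ltW.
  case: (s) s0 => a b /= a0; rewrite lecE /= subrr eqxx /=; lra.
have c0 := mul_adjmx_ge0 (mxC C *m v).
have k0 := mxC_psd (pdmx_psd DD) (mxC K *m v).
have b0 : 0 <= mu%:C * ((mxC (B1^T *m P) *m v)^t* *m (mxC (B1^T *m P) *m v)) 0 0.
  by rewrite mulr_ge0 ?mul_adjmx_ge0 // ler0c ltW.
move: (conj le0 (addr_ge0 (addr_ge0 (addr_ge0 sp c0) k0) b0)) => /andP.
rewrite -eq_le !paddr_eq0 ?addr_ge0 // => /andP[/andP[/andP[_ /eqP Cv]] /eqP Kv _].
have {}Cv : mxC C *m v = 0 by apply/eqP; rewrite -mul_adjmx_eq0 Cv.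
have {}Kv : mxC K *m v = 0.
  apply/eqP/negPn/negP => /(mxC_pd DD); by rewrite Kv ltxx.
move: v0; apply/negP/negPn/eqP; apply: (observable_eigenvector obs _ Cv (s := s)).
by rewrite -Av -AcE /closed_loop mxCB mxCM mulmxBl -mulmxA Kv mulmx0 subr0.
Qed.

End ThetaRiccati.

(** * Feasible pairs and optimal gains *)

Section Feasible.
Variables (R : realType) (n m l q : nat).
Variables (A : 'M[R]_n) (B1 : 'M[R]_(n, l)) (B2 : 'M[R]_(n, m)).
Variables (C : 'M[R]_(q, n)) (D : 'M[R]_(q, m)).
Local Notation feasible := (feasible_set A B1 B2 C D).
Local Notation Th1 := (Theta1 A B1 B2 C D).

(** With [E = V - W], [Theta] at the convex combination falls short of the
    combination of its values by [t (1 - t) E R E], and [R] is a Gram matrix. *)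
Lemma Theta1_convex (V W : 'M[R]_(n + m)) (mu nu t : R) :
  V^T = V -> W^T = W -> 0 <= t <= 1 ->
  psdmx (- Th1 V mu) -> psdmx (- Th1 W nu) ->
  psdmx (- Th1 (t *: V + (1 - t) *: W) (t * mu + (1 - t) * nu)).
Proof.
move=> Vs Ws /andP[t0 t1] hV hW.
pose E := V - W.
have Es : E^T = E by rewrite linearB /= Vs Ws.
have RE : Rmx C D = (block_mx C 0 0 D : 'M[R]_(q + q, n + m))^T *m block_mx C 0 0 D.
  by rewrite tr_block_mx mulmx_block !trmx0 !mulmx0 !mul0mx !addr0 !add0r.
have ThE : Theta A B1 B2 C D (t *: V + (1 - t) *: W) (t * mu + (1 - t) * nu) =
    t *: Theta A B1 B2 C D V mu + (1 - t) *: Theta A B1 B2 C D W nu -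
    (t * (1 - t)) *: (E *m Rmx C D *m E).
  rewrite /Theta /E; move: (Fmx A B2) (Rmx C D) (Qmx m B1) => F G Q.
  rewrite !(mulmxDl, mulmxDr, mulmxN, mulNmx) -!(scalemxAl, scalemxAr) !scalerA.
  move: (F *m V) (F *m W) (V *m F^T) (W *m F^T) => FV FW VF WF.
  move: (V *m G *m V) (V *m G *m W) (W *m G *m V) (W *m G *m W) => a b c d.
  by apply/matrixP => i j; rewrite !mxE; ring.
have -> : - Th1 (t *: V + (1 - t) *: W) (t * mu + (1 - t) * nu) =
    t *: (- Th1 V mu) + (1 - t) *: (- Th1 W nu) +
    (t * (1 - t)) *: ulsubmx (E *m Rmx C D *m E).
  by apply/matrixP => i j; rewrite /Theta1 ThE !mxE; ring.
apply: psdmxD; first by apply: psdmxD; apply: psdmxZ => //; rewrite subr_ge0.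
apply: psdmxZ; first by rewrite mulr_ge0 // subr_ge0.
apply: ulsubmx_psd; rewrite -{1}Es; apply: psdmx_congr.
by rewrite RE; exact: psdmx_gram.
Qed.

Lemma feasible_convex : convex_set feasible.
Proof.
move=> /= [V mu] [W nu] t /set_mem[/= Vpd Vp hV mu0] /set_mem[/= Wpd Wp hW nu0].
apply/mem_set.
have t01 : 0 <= t%:num <= 1 by rewrite ge0 le1.
rewrite -[conv _ _ _]/(t%:num *: V + (1 - t%:num) *: W,
  t%:num * mu + (1 - t%:num) * nu).
move: (t%:num) t01 => {}t t01; have /andP[t0 t1] := t01.
have [->|tpos] := eqVneq t 0.
  by rewrite scale0r mul0r subr0 scale1r mul1r !add0r.
have tgt : 0 < t by rewrite lt_neqAle eq_sym tpos t0.
have s0 : 0 <= 1 - t by rewrite subr_ge0.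
split=> /=.
- have -> : ulsubmx (t *: V + (1 - t) *: W) =
      t *: ulsubmx V + (1 - t) *: ulsubmx W.
    by apply/matrixP => i j; rewrite !mxE.
  split.
    by rewrite linearD !linearZ /= (proj1 Vpd) (proj1 Wpd).
  move=> x x0; rewrite mulmxDr mulmxDl -!(scalemxAl, scalemxAr) !mx11E.
  apply: ltr_wpDr; first by rewrite mulr_ge0 //; exact: (pdmx_psd Wpd).2.
  by rewrite mulr_gt0 //; exact: Vpd.2.
- by apply: psdmxD; apply: psdmxZ.
- by apply: Theta1_convex => //; [exact: Vp.1 | exact: Wp.1].
- by apply: ltr_pwDl; [exact: mulr_gt0 | rewrite mulr_ge0 // ltW].
Qed.

Hypothesis hCD : C^T *m D = 0.
Local Notation ric K := (riccati (closed_loop A B2 K) B1 (C - D *m K)).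

Lemma feasible_riccati (W : 'M[R]_(n + m)) mu : feasible (W, mu) ->
  psdmx (- ric (gain W) (invmx (ulsubmx W)) mu).
Proof.
case=> /= W1pd [Ws _] Th _; have W1u := pdmx_unit W1pd.
move: Th; set W1 := ulsubmx W; set K := gain W.
have KW : K *m W1 = dlsubmx W by rewrite /K /gain mulmxKV // trmx_ursub Ws.
have WK : W1 *m K^T = ursubmx W.
  by rewrite -[W1](proj1 W1pd) -trmx_mul KW trmx_dlsub Ws.
have -> : W = block_mx W1 (W1 *m K^T) (K *m W1) (drsubmx W).
  by rewrite KW WK submxK.
rewrite Theta1_riccati // => /(psdmx_congr (invmx W1)).
rewrite trmx_inv (proj1 W1pd) -mulNmx -mulmxN !mulmxA mulVmx // mul1mx.
by rewrite mulmxK.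
Qed.

(** The choice [W3 = K W1 K^T] is the smallest one for which the block matrix,
    here [(1 K^T)^T W1 (1 K^T)], is positive semidefinite. *)
Lemma riccati_feasible (K : 'M[R]_(m, n)) (P : 'M[R]_n) mu :
  0 < mu -> pdmx P -> psdmx (- ric K P mu) -> exists W, feasible (W, mu).
Proof.
move=> mu0 Ppd hric; have Pu := pdmx_unit Ppd.
have W1pd := pdmx_inv Ppd; set W1 := invmx P in W1pd.
exists (block_mx W1 (W1 *m K^T) (K *m W1) (K *m W1 *m K^T)); split=> //=.
- by rewrite block_mxKul.
- have -> : block_mx W1 (W1 *m K^T) (K *m W1) (K *m W1 *m K^T) =
      (row_mx 1%:M K^T)^T *m W1 *m row_mx 1%:M K^T.
    by rewrite tr_row_mx trmx1 trmxK mul_col_mx mul1mx mul_col_row !mulmx1.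
  exact/psdmx_congr/pdmx_psd.
- rewrite Theta1_riccati ?unitmx_inv // -mulNmx -mulmxN invmxK.
  by rewrite -{1}(proj1 W1pd); apply: psdmx_congr.
Qed.

End Feasible.

Section Hinf.
Variables (R : realType) (n m l q : nat).
Variables (A : 'M[R]_n) (B1 : 'M[R]_(n, l)) (B2 : 'M[R]_(n, m)).
Variables (C : 'M[R]_(q, n)) (D : 'M[R]_(q, m)) (K : 'M[R]_(m, n)).
Local Notation Hinf := (Hinf_norm A B1 B2 C D).
Local Notation tf K w := (transfer A B1 B2 C D K (0 +i* w)).

Lemma Hinf_norm_le (g : R) :
  (Hinf K <= g%:E)%E <-> forall w, sigma_max (tf K w) <= g.
Proof.
split=> [h w|h].
  by rewrite -lee_fin (le_trans _ h) //; apply: ereal_sup_ubound; exists w.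
by apply: ge_ereal_sup => _ [w _ <-]; rewrite lee_fin.
Qed.

Lemma Hinf_norm_ge0 : (0 <= Hinf K)%E.
Proof.
apply: (@le_trans _ _ (sigma_max (tf K 0))%:E); first by rewrite lee_fin sigma_max_ge0.
by apply: ereal_sup_ubound; exists 0.
Qed.

End Hinf.

Section Main.
Variables (R : realType) (n m l q : nat).
Variables (A : 'M[R]_n) (B1 : 'M[R]_(n, l)) (B2 : 'M[R]_(n, m)).
Variables (C : 'M[R]_(q, n)) (D : 'M[R]_(q, m)).
Hypotheses (obs : observable A C) (hCD : C^T *m D = 0) (hDD : pdmx (D^T *m D)).
Local Notation feasible := (feasible_set A B1 B2 C D).
Local Notation Hinf := (Hinf_norm A B1 B2 C D).

(** The sufficiency half: a Riccati certificate gives stability, then the norm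
    bound. *)
Lemma feasible_gain (W : 'M[R]_(n + m)) mu : feasible (W, mu) ->
  stabilizing A B2 (gain W) /\ (Hinf (gain W) <= (1 / Num.sqrt mu)%:E)%E.
Proof.
move=> fW; have ric := feasible_riccati hCD fW.
case: (fW) => /= W1pd _ _ mu0; have Ppd := pdmx_inv W1pd.
have st := riccati_stable hCD obs hDD mu0 Ppd ric.
split=> //; apply/Hinf_norm_le => w; apply: sigma_max_le => [|u].
  by rewrite divr_ge0 ?sqrtr_ge0.
rewrite div1r exprVn (sqr_sqrtr (ltW mu0)).
exact: (bounded_real mu0 st (proj1 Ppd) ric).
Qed.

(** The necessity half.  A number strictly between the norm and [g] is needed,
    as the norm itself may not be certified by any [P]. *)
Lemma attenuation_feasible (K : 'M[R]_(m, n)) (g : R) :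
  stabilizing A B2 K -> (Hinf K < g%:E)%E ->
  exists (W : 'M[R]_(n + m)) (mu : R), feasible (W, mu) /\ 1 / Num.sqrt mu < g.
Proof.
move=> st Hg; have H0 := Hinf_norm_ge0 A B1 B2 C D K.
case HE : (Hinf K) H0 Hg => [h| |] //; rewrite lee_fin lte_fin => h0 hg.
have [hg1 hg2] := midf_lt hg; set g1 := (h + g) / 2 in hg1 hg2.
have g10 : 0 < g1 by exact: le_lt_trans hg1.
have hsig : forall w, sigma_max (transfer A B1 B2 C D K (0 +i* w)) <= h.
  by apply/Hinf_norm_le; rewrite HE.
have [P Ppd ric] := strict_bounded_real st h0 hg1 hsig.
have mu0 : 0 < g1 ^- 2 by rewrite invr_gt0 exprn_gt0.
have [W fW] := riccati_feasible hCD mu0 Ppd ric.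
exists W, (g1 ^- 2); split=> //.
by rewrite sqrtrV ?exprn_ge0 ?ltW // sqrtr_sqr gtr0_norm // div1r invrK.
Qed.

Lemma feasible_optimal (W : 'M[R]_(n + m)) mu : feasible (W, mu) ->
  (forall W' mu', feasible (W', mu') -> mu' <= mu) ->
  forall K, stabilizing A B2 K -> ((1 / Num.sqrt mu)%:E <= Hinf K)%E.
Proof.
move=> fW mumax K st; rewrite leNgt; apply/negP => /(attenuation_feasible st).
case=> W' [nu [fW' ]]; apply/negP; rewrite -leNgt.
case: fW fW' (mumax _ _ fW') => /= _ _ _ mu0 [/= _ _ _ nu0] le.
rewrite !div1r lef_pV2 ?posrE ?sqrtr_gt0 //; exact: ler_wsqrtr.
Qed.

End Main.

Theorem theorem1 (R : realType) (n m l q : nat)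
    (A : 'M[R]_n) (B1 : 'M[R]_(n, l)) (B2 : 'M[R]_(n, m))
    (C : 'M[R]_(q, n)) (D : 'M[R]_(q, m))
    (hstab : exists gamma : R,
       0 < gamma /\ stabilizable_with_attenuation A B1 B2 C D gamma)
    (hobs : observable A C)
    (hCD : C^T *m D = 0)
    (hDD : pdmx (D^T *m D)) :
  [/\ convex_set (feasible_set A B1 B2 C D),
      forall (W : 'M[R]_(n + m)) (mu : R),
        feasible_set A B1 B2 C D (W, mu) ->
        [/\ stabilizing A B2 (gain W),
            0 < 1 / Num.sqrt mu
          & (Hinf_norm A B1 B2 C D (gain W) <= (1 / Num.sqrt mu)%:E)%E]
    & forall (W : 'M[R]_(n + m)) (mu : R),
        feasible_set A B1 B2 C D (W, mu) ->
        (forall (W' : 'M[R]_(n + m)) (mu' : R),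
           feasible_set A B1 B2 C D (W', mu') -> mu' <= mu) ->
        [/\ Hinf_optimal_gain A B1 B2 C D (gain W),
            Hinf_norm A B1 B2 C D (gain W) = (1 / Num.sqrt mu)%:E
          & Hinf_optimal_value A B1 B2 C D = (1 / Num.sqrt mu)%:E] ].
Proof.
split=> [|W mu fW|W mu fW mumax]; first exact: feasible_convex.
  have [st le] := feasible_gain hobs hCD hDD fW; split=> //.
  by case: fW => /= _ _ _ mu0; rewrite divr_gt0 // sqrtr_gt0.
have [st le] := feasible_gain hobs hCD hDD fW.
have opt := feasible_optimal hCD fW mumax.
have HE : Hinf_norm A B1 B2 C D (gain W) = (1 / Num.sqrt mu)%:E.
  by apply/eqP; rewrite eq_le le opt.
split; [split; first exact: st | exact: HE | ].
  by move=> K stK; rewrite HE; exact: opt.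
apply/eqP; rewrite eq_le; apply/andP; split.
  by rewrite -HE; apply: ereal_inf_lbound; exists (gain W).
by apply: le_ereal_inf_tmp => _ [K stK <-]; exact: opt.
Qed.
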